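(* Let $\Omega$ be a domain of the hexagonal lattice $\mathbb H$ and $0<x\le1$. Then, under $\mathsf{Spin}_{\Omega,x}$, the triplet $(\sigma^\bullet,\xi^{\bullet+},-\xi^{\bullet-})$ satisfies the FKG inequality. The same holds also for $(\sigma^\circ,\xi^{\circ+},-\xi^{\circ-})$ and when boundary conditions of the form $\bullet+$, $\bullet-$ and/or $\circ+$, $\circ-$ are imposed. In fact, the triplet $(\sigma^\bullet,\xi^{\bullet+},-\xi^{\bullet-})$ also satisfies the FKG inequality under the measures $$\mathsf{Spin}_{\Omega,x}(\,\cdot\mid\{\sigma^\bullet|_A=\tau\})\quad\text{and}\quad\mathsf{Spin}^{\circ+}_{\Omega,x}(\,\cdot\mid\{\sigma^\bullet|_A=\tau\})$$ for any $A\subset F(\Omega)$ and $\tau:A\to\{\pm1\}$.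
   Context: $\mathbb H$ is the hexagonal lattice with faces centred at $\{k+\ell e^{i\pi/3}:k,\ell\in\mathbb Z\}\subset\mathbb C$; $Y(\mathbb H)\subset V(\mathbb H)$ is the set of top endpoints of vertical edges. A domain is a finite subgraph $\Omega\subset\mathbb H$ consisting precisely of the vertices and edges on or inside a cycle $\partial\Omega$ of $\mathbb H$. $F(\Omega)$ is the set of faces enclosed by $\partial\Omega$; $\partial_F\Omega\subset F(\Omega)$ the set of those adjacent to $\partial\Omega$; $Y(\Omega)=(Y(\mathbb H)\cap V(\Omega))\setminus V(\partial\Omega)$. For $\sigma\in\{\pm1\}^{F(\Omega)}$, $\omega[\sigma]$ is the set of edges in $E(\Omega)\setminus E(\partial\Omega)$ separating two faces with different $\sigma$-values, and $Y[\sigma]\subset Y(\Omega)$ is the set of vertices of $Y(\Omega)$ incident to edges of $\omega[\sigma]$. Write $\sigma^\bullet\perp\sigma^\circ$ (consistent) if for any adjacent faces $u,v\in F(\Omega)$, $\sigma^\bullet(u)=\sigma^\bullet(v)$ or $\sigma^\circ(u)=\sigma^\circ(v)$. $\mathsf{Spin}_{\Omega,x}$ is the probability measure on consistent pairs of spin configurations with $\mathsf{Spin}_{\Omega,x}(\sigma^\bullet,\sigma^\circ)\propto(x^2)^{|Y[\sigma^\bullet]\cup Y[\sigma^\circ]|}$. Boundary conditions $\bullet\pm$ (resp. $\circ\pm$), indicated by superscripts, mean conditioning on $\sigma^\bullet|_{\partial_F\Omega}\equiv\pm$ (resp. $\sigma^\circ|_{\partial_F\Omega}\equiv\pm$). All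 measures are extended by an independent family $(U_y)_{y\in Y(\Omega)}$ of i.i.d. uniform $[0,1]$ variables. Write $\sigma\perp y$ if $\sigma$ takes the same value on the three faces around $y$. The percolations $\xi^\bullet,\xi^\circ\subset Y(\Omega)$ (identified with indicators) are defined by: $\xi^\bullet(y)=0,\ \xi^\circ(y)=1$ if $\sigma^\bullet\not\perp y$; $\xi^\bullet(y)=1,\ \xi^\circ(y)=0$ if $\sigma^\circ\not\perp y$; $\xi^\bullet(y)=\mathbf 1\{U_y\le x^2\}$, $\xi^\circ(y)=\mathbf 1\{U_y>1-x^2\}$ if $\sigma^\bullet\perp y$ and $\sigma^\circ\perp y$. Let $\xi^{\bullet\pm}$ be the set of $y\in\xi^\bullet$ with $\sigma^\bullet\equiv\pm$ around $y$, and $\xi^{\circ\pm}$ the set of $y\in\xi^\circ$ with $\sigma^\circ\equiv\pm$ around $y$. The triplet $(\sigma^\bullet,\xi^{\bullet+},-\xi^{\bullet-})$ means $(\sigma^\bullet,\mathbf 1_{\xi^{\bullet+}},-\mathbf 1_{\xi^{\bullet-}})$, a random variable in a product of subsets of $\mathbb R$ with the pointwise partial order (similarly for white). A random variable $X$ with values in a product $A=\prod_{i\in I}A_i$, $A_i\subset\mathbb R$, satisfies the FKG inequality if $\mathbb E[f(X)g(X)]\ge\mathbb E[f(X)]\,\mathbb E[g(X)]$ for all bounded increasing $f,g:A\to\mathbb R$. *)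

(* Defs.v *)
From HB Require Import structures.
From mathcomp Require Import all_boot all_order all_algebra finmap.
From mathcomp Require Import all_classical all_reals all_analysis.

Set Implicit Arguments.
Unset Strict Implicit.
Unset Printing Implicit Defensive.

Import Order.TTheory GRing.Theory Num.Theory.
Import numFieldNormedType.Exports.

Local Open Scope classical_set_scope.
Local Open Scope ring_scope.

(** * The hexagonal lattice

    The face (k, l) is the hexagon centred at k + l e^(i pi/3).  Every vertex of
    the lattice is an endpoint of exactly one vertical edge, and the vertical
    edges are those separating the faces (k, l) and (k + 1, l): the vertex
    ((k, l), true) is the top endpoint of that edge, ((k, l), false) the bottom
    one. *)

Definition face := (int * int)%type.
Definition vertex := (face * bool)%type.

Definition is_top (v : vertex) : bool := v.2.

Definition vfaces (v : vertex) : seq face :=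
  let: (k, l) := v.1 in
  [:: (k, l); (k + 1, l); (if v.2 then (k, l + 1) else (k + 1, l - 1))].

(* The six vertices of the hexagon u, that is, the v with u \in vfaces v. *)
Definition fvertices (u : face) : seq vertex :=
  let: (k, l) := u in
  [:: ((k, l), true); ((k - 1, l), true); ((k, l - 1), true);
      ((k, l), false); ((k - 1, l), false); ((k - 1, l + 1), false)].

(* Two vertices are joined by an edge iff they have exactly two faces in common,
   namely the two faces on either side of that edge. *)
Definition vadj : rel vertex :=
  fun v w => count (mem (vfaces w)) (vfaces v) == 2%N.

(* Faces sharing an edge: their centres are at distance 1. *)
Definition fadj : rel face :=
  fun u v => (v.1 - u.1, v.2 - u.2) \in
    [:: (1, 0); (0, 1); (-1, 1); (-1, 0); (0, -1); (1, -1)].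

(* The lattice is bipartite: an edge joins a top endpoint (of a vertical edge)
   to a bottom one.  It is stored as the pair (top one, bottom one). *)
Definition edge := (vertex * vertex)%type.
Definition is_edge (e : edge) : bool := is_top e.1 && vadj e.1 e.2.

Definition sides (e : edge) : seq face := [seq u <- vfaces e.1 | u \in vfaces e.2].

(** * Domains *)

(* The size condition rules out the degenerate closed walk v, w, v. *)
Definition simple_cycle (c : seq vertex) : Prop :=
  ucycle vadj c /\ (2 < size c)%N.

Definition cycle_edges (c : seq vertex) : seq edge :=
  [seq if is_top a then (a, next c a) else (next c a, a) | a <- c].

Definition separated (c : seq vertex) : rel face :=
  fun u v => has (fun e => (u \in sides e) && (v \in sides e)) (cycle_edges c).

(* The faces lying in the same connected component of the complement of the
   closed curve c as u. *)
Definition component (c : seq vertex) (u : face) : set face :=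
  [set v | exists2 p : seq face,
     path (fun a b => fadj a b && ~~ separated c a b) u p & last u p = v].

(* u lies in a bounded component of the complement of c. *)
Definition enclosed (c : seq vertex) (u : face) : Prop :=
  finite_set (component c u).

(* The field [dfacesP] determines [dfaces], so that a domain amounts to its
   boundary cycle; vertices and edges are recovered below. *)
Record domain := Domain {
  boundary : seq vertex;
  dfaces : {fset face};
  boundaryP : simple_cycle boundary;
  dfacesP : forall u, u \in dfaces <-> enclosed boundary u }.

(* Vertices on or inside the cycle. *)
Definition dvertices (Om : domain) : {fset vertex} :=
  [fset v in boundary Om ++ flatten [seq fvertices u | u <- dfaces Om]]%fset.

(* Edges on or inside the cycle. *)
Definition dedges (Om : domain) : {fset edge} :=
  [fset e in allpairs pair (dvertices Om) (dvertices Om) | is_edge e &&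
     ((e \in cycle_edges (boundary Om)) || has (mem (dfaces Om)) (sides e))]%fset.

Definition dY (Om : domain) : {fset vertex} :=
  [fset y in dvertices Om | is_top y && (y \notin boundary Om)]%fset.

Definition bdry_face (Om : domain) (u : face) : bool :=
  (u \in dfaces Om) && has (fun e => u \in sides e) (cycle_edges (boundary Om)).

(** * Spin configurations; true stands for +1 and false for -1 *)

Definition spins (Om : domain) := {ffun dfaces Om -> bool}.

(* Pairs (black configuration, white configuration). *)
Definition state (Om : domain) := (spins Om * spins Om)%type.

Definition omega (Om : domain) (s : spins Om) : {set dedges Om} :=
  [set e : dedges Om | (val e \notin cycle_edges (boundary Om)) &&
     [exists u : dfaces Om, exists v : dfaces Om,
        [&& val u \in sides (val e), val v \in sides (val e) & s u != s v]]].

Definition Yset (Om : domain) (s : spins Om) : {set dY Om} :=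
  [set y : dY Om | [exists e in omega s,
     (val y == (val e).1) || (val y == (val e).2)]].

Definition consistent (Om : domain) (sb sw : spins Om) : bool :=
  [forall u : dfaces Om, forall v : dfaces Om, fadj (val u) (val v) ==>
     (sb u == sb v) || (sw u == sw v)].

(** * The measures, given by their mass functions on [state] *)

Definition weight (R : realType) (Om : domain) (x : R) (s : state Om) : R :=
  if consistent s.1 s.2 then (x ^+ 2) ^+ #|Yset s.1 :|: Yset s.2| else 0.

Definition Spin (R : realType) (Om : domain) (x : R) (s : state Om) : R :=
  weight x s / \sum_(t : state Om) weight x t.

Definition cond (R : realType) (Om : domain) (p : state Om -> R)
    (C : {set state Om}) (s : state Om) : R :=
  if s \in C then p s / \sum_(t in C) p t else 0.

(* Boundary condition: None is free, Some true is +, Some false is -. *)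
Definition satisfies_bc (Om : domain) (b : option bool) (s : spins Om) : bool :=
  if b is Some v then [forall u : dfaces Om, bdry_face Om (val u) ==> (s u == v)]
  else true.

Definition Spin_bc (R : realType) (Om : domain) (x : R) (bb bw : option bool) :
    state Om -> R :=
  cond (Spin x) [set s : state Om | satisfies_bc bb s.1 && satisfies_bc bw s.2].

Definition black_on (Om : domain) (A : {set dfaces Om})
    (tau : {u : dfaces Om | u \in A} -> bool) : {set state Om} :=
  [set s : state Om | [forall a : {u : dfaces Om | u \in A}, s.1 (val a) == tau a]].

(* On (T, P), the pair S of spin configurations has mass function p, the
   variables (U y) are i.i.d. uniform on [0, 1], and they are independent of S. *)
Definition extended_law (R : realType) (Om : domain) (d : measure_display)
    (T : measurableType d) (P : probability T R) (p : state Om -> R)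
    (S : T -> state Om) (U : dY Om -> T -> R) : Prop :=
  [/\ forall s : state Om, measurable [set t | S t = s],
      forall y, measurable_fun setT (U y) &
      forall (s : state Om) (B : dY Om -> set R), (forall y, measurable (B y)) ->
        P [set t | S t = s /\ forall y, B y (U y t)] =
        ((p s)%:E * \prod_(y : dY Om) uniform_prob (@ltr01 R) (B y))%E].

(** * Percolations *)

Definition around (Om : domain) (b : bool) (s : spins Om) (y : dY Om) : bool :=
  [forall u : dfaces Om, (val u \in vfaces (val y)) ==> (s u == b)].

Definition perp (Om : domain) (s : spins Om) (y : dY Om) : bool :=
  [exists b, around b s y].

(* For consistent pairs the first two cases exclude each other. *)
Definition xi_black (R : realType) (Om : domain) (x : R) (s : state Om)
    (u : dY Om -> R) (y : dY Om) : bool :=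
  if ~~ perp s.1 y then false
  else if ~~ perp s.2 y then true
  else u y <= x ^+ 2.

Definition xi_white (R : realType) (Om : domain) (x : R) (s : state Om)
    (u : dY Om -> R) (y : dY Om) : bool :=
  if ~~ perp s.1 y then true
  else if ~~ perp s.2 y then false
  else 1 - x ^+ 2 < u y.

(** * Triplets and the FKG inequality *)

Definition triplet_index (Om : domain) : Type :=
  (dfaces Om + (dY Om + dY Om))%type.

Definition triplet_space (R : realType) (Om : domain) (i : triplet_index Om) :
    set R :=
  match i with
  | inl _ => [set -1; 1]
  | inr (inl _) => [set 0; 1]
  | inr (inr _) => [set -1; 0]
  end.
Arguments triplet_space R {Om} i.

Definition triplet (R : realType) (Om : domain) (s : spins Om) (xi : dY Om -> bool)
    (i : triplet_index Om) : R :=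
  match i with
  | inl u => if s u then 1 else -1
  | inr (inl y) => (xi y && around true s y)%:R
  | inr (inr y) => - (xi y && around false s y)%:R
  end.
Arguments triplet R {Om} s xi i.

Lemma triplet_inE (R : realType) (Om : domain) (s : spins Om)
    (xi : dY Om -> bool) (i : triplet_index Om) :
  triplet_space R i (triplet R s xi i).
Proof.
case: i => [u|[y|y]] /=; first by case: ifP; [right|left].
  by case: (_ && _); [right|left].
by case: (_ && _); [left|right; rewrite oppr0].
Qed.

Definition black_triplet (R : realType) (Om : domain) (T : Type) (x : R)
    (S : T -> state Om) (U : dY Om -> T -> R) (t : T) : triplet_index Om -> R :=
  triplet R (S t).1 (xi_black x (S t) (U^~ t)).

Definition white_triplet (R : realType) (Om : domain) (T : Type) (x : R)
    (S : T -> state Om) (U : dY Om -> T -> R) (t : T) : triplet_index Om -> R :=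
  triplet R (S t).2 (xi_white x (S t) (U^~ t)).

Definition product_set (R : realType) (I : Type) (A : I -> set R) : set (I -> R) :=
  [set z | forall i, A i (z i)].

(* Only the values of f on the product set matter for these two predicates, so
   f : (I -> R) -> R stands for an arbitrary function on the product set. *)
Definition bounded_on (R : realType) (I : Type) (A : I -> set R)
    (f : (I -> R) -> R) : Prop :=
  exists M : R, forall z, product_set A z -> `|f z| <= M.

Definition increasing_on (R : realType) (I : Type) (A : I -> set R)
    (f : (I -> R) -> R) : Prop :=
  forall z w, product_set A z -> product_set A w ->
    (forall i, z i <= w i) -> f z <= f w.

(* X is meant to take its values in the product of the A i.  Measurability of f
   and g is not required: it is automatic for the finite products used here. *)
Definition FKG (R : realType) (d : measure_display) (T : measurableType d)
    (P : probability T R) (I : Type) (A : I -> set R) (X : T -> I -> R) : Prop :=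
  forall f g : (I -> R) -> R,
    bounded_on A f -> increasing_on A f -> bounded_on A g -> increasing_on A g ->
    ('E_P[fun t => f (X t)] * 'E_P[fun t => g (X t)] <=
     'E_P[fun t => (f (X t) * g (X t))%R])%E.

(* Main.v *)
Require Import Defs.
From HB Require Import structures.
From mathcomp Require Import all_boot all_order all_algebra finmap.
From mathcomp Require Import zify ring lra.

(** Fix the colour whose triplet is studied, call its configuration s and its set
    of + faces A, and let t be the other configuration.  Sample a Bernoulli(x^2)
    subset U of Y(Omega): this is the set of y with U_y <= x^2 for black, and with
    U_y > 1 - x^2 for white.

    Integrating t out.  The other colour has weight x^2 at each vertex where it
    is not constant, and at those vertices the percolation is forced to be open.
    Having to be open and paying x^2 is the same as being open by chance, so both
    constraints can be traded: the weight of (s, U) becomes x^2 to the power of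
    the number of vertices where s is not constant, times the number of t that are
    constant around every closed vertex and agree across every edge where s
    changes ([sum_other_colour]).  These t form, up to a global sign, a vector
    space over the field with two elements.

    Decoupling the two signs.  That space is the sum of two subspaces, the first
    of functions that vary only inside A, the second of functions that vary only
    inside the complement of A; their intersection does not depend on A
    ([tied_split]).  This is where planarity enters.  Given t, its variation along
    the edges inside A is a cocycle modulo 2, because t is constant across the
    interfaces of s; a domain has no holes, so this cocycle is the variation of a
    function ([acyclic_domain]), which is the first component of t.  If t is
    prescribed on the boundary faces, that component is constant there, as one
    sees by following the boundary cycle ([domain_split]).

    The lattice condition.  Hence the weight factorises into a factor for (A, U),
    one for (complement of A, U'), where U and U' may be taken independent, one
    for each sign, and a power of x^2 depending on A only ([spin_massE]).  That
    power is log-supermodular because the number of vertices where s is not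
    constant is submodular in A.  The number of solutions of a linear system over
    the field with two elements is a supermodular function of the system
    (#|V| #|W| = #|V + W| #|V :&: W|).  So the weight of (A, U, U') satisfies the
    FKG lattice condition when A and U are ordered by inclusion and U' by reverse
    inclusion ([density_lattice]).  The triplet is an increasing function of
    (A, U, U'), and the four functions theorem of Ahlswede and Daykin concludes
    ([model_fkg]).  Conditioning on the values of s on a set of faces restricts A
    to a sublattice, and a boundary condition on t adds equations to the linear
    system: both fit in the same argument. *)

Set Implicit Arguments.
Unset Strict Implicit.
Unset Printing Implicit Defensive.

Import Order.TTheory GRing.Theory Num.Theory.

Local Open Scope ring_scope.

(** * Correlation inequalities on sets *)

Section FourFunctions.
Context (R : realFieldType).

(** The four functions theorem on the two-element lattice. *)
Lemma four_functions_two_points (a0 a1 b0 b1 c0 c1 d0 d1 : R) :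
  0 <= a0 -> 0 <= a1 -> 0 <= b0 -> 0 <= b1 ->
  0 <= c0 -> 0 <= c1 -> 0 <= d0 -> 0 <= d1 ->
  a0 * b0 <= c0 * d0 -> a0 * b1 <= c1 * d0 ->
  a1 * b0 <= c1 * d0 -> a1 * b1 <= c1 * d1 ->
  (a0 + a1) * (b0 + b1) <= (c0 + c1) * (d0 + d1).
Proof.
move=> a0p a1p b0p b1p c0p c1p d0p d1p h00 h01 h10 h11.
have e01 : 0 <= a0 * b1 by exact: mulr_ge0.
have e10 : 0 <= a1 * b0 by exact: mulr_ge0.
have f01 : 0 <= c0 * d1 by exact: mulr_ge0.
suff k : a0 * b1 + a1 * b0 <= c1 * d0 + c0 * d1.
  have -> : (a0 + a1) * (b0 + b1) = a0 * b0 + a1 * b1 + (a0 * b1 + a1 * b0).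
    by ring.
  have -> : (c0 + c1) * (d0 + d1) = c0 * d0 + c1 * d1 + (c1 * d0 + c0 * d1).
    by ring.
  by apply: lerD => //; apply: lerD.
set u := a0 * b1 in h01 e01 *; set v := a1 * b0 in h10 e10 *.
set t := c1 * d0 in h01 h10 *; set w := c0 * d1 in f01 *.
have uv : u * v <= w * t.
  have -> : u * v = (a0 * b0) * (a1 * b1) by rewrite /u /v; ring.
  have -> : w * t = (c0 * d0) * (c1 * d1) by rewrite /w /t; ring.
  by apply: ler_pM => //; apply: mulr_ge0.
have tp : 0 <= t by apply: mulr_ge0.
have [t0|tn] := eqVneq t 0.
  have -> : u = 0 by apply/eqP; rewrite eq_le e01 -t0 h01.
  have -> : v = 0 by apply/eqP; rewrite eq_le e10 -t0 h10.
  by rewrite addr0 addr_ge0.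
have tpos : 0 < t by rewrite lt_neqAle eq_sym tn tp.
rewrite -(ler_pM2r tpos).
have : 0 <= (t - u) * (t - v) by apply: mulr_ge0; rewrite subr_ge0.
by nra.
Qed.

(** The theorem of Ahlswede and Daykin, by induction on the ground set: summing
    each function over the presence of one element preserves the hypothesis, by
    the two-point case. *)
Lemma four_functions (I : finType) (a b c d : {set I} -> R) :
  (forall X, 0 <= a X) -> (forall X, 0 <= b X) ->
  (forall X, 0 <= c X) -> (forall X, 0 <= d X) ->
  (forall X Z, a X * b Z <= c (X :|: Z) * d (X :&: Z)) ->
  (\sum_X a X) * (\sum_X b X) <= (\sum_X c X) * (\sum_X d X).
Proof.
pose sub (K : {set I}) (f : {set I} -> R) := \sum_(X in powerset K) f X.
have subT f : \sum_X f X = sub [set: I] f.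
  by apply: eq_bigl => X; rewrite powersetT inE.
rewrite !subT.
have subU (K : {set I}) k (f : {set I} -> R) : k \notin K ->
    sub (k |: K) f = sub K (fun X => f X + f (k |: X)).
  move=> kK; rewrite /sub (bigID (fun X : {set I} => k \in X)) /= big_split /=.
  rewrite addrC; congr (_ + _).
    apply: eq_bigl => X; rewrite !powersetE.
    apply/andP/idP => [[sX kX]|sX].
      by rewrite -(setU1K kK) subsetD1 sX kX.
    by rewrite (subset_trans sX (subsetUr _ _)) (contra (subsetP sX k)).
  rewrite (reindex_onto (fun X => k |: X) (fun X => X :\ k)) /=; last first.
    by move=> X /andP[_ kX]; rewrite setD1K.
  apply: eq_bigl => X; rewrite !powersetE setU11 andbT.
  apply/andP/idP => [[sX /eqP <-]|sX].
    by rewrite subDset.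
  by rewrite setU1K ?eqxx ?setUS // (contra (subsetP sX k)).
move=> a0 b0 c0 d0 H0.
have {H0} : forall X Z : {set I}, X \subset setT -> Z \subset setT ->
  a X * b Z <= c (X :|: Z) * d (X :&: Z) by move=> X Z _ _; apply: H0.
have [m] := ubnP #|[set: I]|.
move: [set: I] => K; elim: m K a b c d a0 b0 c0 d0 => // m IH K a b c d.
have [-> _ _ _ _ _ H|[k kK]] := set_0Vmem K.
  rewrite /sub powerset0 !big_set1.
  by have := H set0 set0 (sub0set _) (sub0set _); rewrite setU0 setI0.
move=> a0 b0 c0 d0; rewrite (cardsD1 k) kK ltnS => cK H.
rewrite -(setD1K kK) !subU ?setD11 //.
apply: IH => //; try by move=> X; apply: addr_ge0.
move=> X Z sX sZ.
have kX : k \notin X by apply/negP => /(subsetP sX); rewrite setD11.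
have kZ : k \notin Z by apply/negP => /(subsetP sZ); rewrite setD11.
have {}sX := subset_trans sX (subD1set _ _).
have {}sZ := subset_trans sZ (subD1set _ _).
have kXK : k |: X \subset K by rewrite subUset sub1set kK.
have kZK : k |: Z \subset K by rewrite subUset sub1set kK.
apply: four_functions_two_points => //; first exact: H.
- have := H X (k |: Z) sX kZK.
  by rewrite setUCA setIC setIUl (setIC Z) disjoint_setI0 ?set0U // disjoints1.
- have := H (k |: X) Z kXK sZ.
  by rewrite -setUA setIUl disjoint_setI0 ?set0U // disjoints1.
- have := H (k |: X) (k |: Z) kXK kZK.
  by rewrite -setUIr setUACA setUid.
Qed.

(** The last argument is ordered by reverse inclusion: it stands for the set of
    open vertices surrounded by the sign -. *)
Definition increasing3 (I J : finType) (f : {set I} -> {set J} -> {set J} -> R) :=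
  forall (A A' : {set I}) (U U' V V' : {set J}),
  A \subset A' -> U \subset U' -> V' \subset V -> f A U V <= f A' U' V'.

Definition mass3 (I J : finType) (m h : {set I} -> {set J} -> {set J} -> R) :=
  \sum_A \sum_U \sum_V m A U V * h A U V.

(** The four functions theorem applied to m f, m g, m f g and m, one argument
    after the other; subtracting the least values of f and g makes them
    nonnegative without changing the covariance. *)
Lemma fkg_three_sets (I J : finType) (m f g : {set I} -> {set J} -> {set J} -> R) :
  (forall A U V, 0 <= m A U V) ->
  (forall A U V A' U' V',
     m A U V * m A' U' V' <=
     m (A :|: A') (U :|: U') (V :&: V') * m (A :&: A') (U :&: U') (V :|: V')) ->
  increasing3 f ->
  increasing3 g ->
  mass3 m f * mass3 m g <=
  mass3 m (fun A U V => f A U V * g A U V) * mass3 m (fun _ _ _ => 1).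
Proof.
pose E := mass3 m; rewrite -/E => m0 mm fi gi.
have eqE h h' : (forall A U V, h A U V = h' A U V) -> E h = E h'.
  by move=> e; do 3 apply: eq_bigr => ? _; rewrite ?e.
have ED h h' : E (fun A U V => h A U V + h' A U V) = E h + E h'.
  rewrite /E /mass3 -big_split; apply: eq_bigr => A _ /=.
  rewrite -big_split; apply: eq_bigr => U _ /=.
  by rewrite -big_split; apply: eq_bigr => V _ /=; rewrite mulrDr.
have EZ c h : E (fun A U V => c * h A U V) = c * E h.
  rewrite /E /mass3 mulr_sumr; apply: eq_bigr => A _.
  rewrite mulr_sumr; apply: eq_bigr => U _.
  by rewrite mulr_sumr; apply: eq_bigr => V _; rewrite mulrCA.
wlog [f0 g0] : f g fi gi / (forall A U V, 0 <= f A U V) /\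
    (forall A U V, 0 <= g A U V).
  move=> W; set c := f set0 set0 setT; set c' := g set0 set0 setT.
  have /= := W (fun A U V => f A U V + (- c) * 1) (fun A U V => g A U V + (- c') * 1).
  rewrite !ED !EZ.
  rewrite (eqE (fun A U V => (f A U V + - c * 1) * (g A U V + - c' * 1))
     (fun A U V => f A U V * g A U V + ((- c) * g A U V +
         ((- c') * f A U V + (c * c') * 1)))); last by move=> *; ring.
  rewrite !ED !EZ => H.
  rewrite -subr_ge0 (_ : _ - _ =
    (E (fun A U V => f A U V * g A U V) +
     (- c * E g + (- c' * E f + c * c' * E (fun _ _ _ => 1)))) *
    E (fun _ _ _ => 1) -
    (E f + - c * E (fun _ _ _ => 1)) * (E g + - c' * E (fun _ _ _ => 1))); last by ring.
  rewrite subr_ge0; apply: H => [A A' U U' V V' *|A A' U U' V V' *|].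
  - by rewrite lerD2r fi.
  - by rewrite lerD2r gi.
  - by split=> A U V; rewrite mulr1 subr_ge0 (fi, gi) ?sub0set ?subsetT.
have fg0 A U V : 0 <= f A U V * g A U V by apply: mulr_ge0.
apply: four_functions; try by move=> A; do 2 apply: sumr_ge0 => ? _; apply: mulr_ge0.
move=> A A'.
apply: four_functions; try by move=> U; apply: sumr_ge0 => ? _; apply: mulr_ge0.
move=> U U'; rewrite [leRHS]mulrC.
apply: four_functions; try by move=> V; apply: mulr_ge0.
move=> V V'; rewrite [leRHS]mulrC mulr1.
rewrite mulrACA [leRHS]mulrAC; apply: ler_pM; rewrite ?mulr_ge0 //.
by apply: ler_pM => //; [apply: fi|apply: gi]; rewrite ?subsetUl ?subsetUr ?subsetIl ?subsetIr.
Qed.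
End FourFunctions.

(** * Bernoulli sets *)

Section Bernoulli.
Context (R : realFieldType) (Y : finType) (p : R).

Definition bernoulli (U : {set Y}) : R := \prod_y (if y \in U then p else 1 - p).

Lemma bernoulli_ge0 U : 0 <= p <= 1 -> 0 <= bernoulli U.
Proof.
by case/andP=> p0 p1; apply: prodr_ge0 => y _; case: ifP; rewrite ?subr_ge0.
Qed.

Lemma sum_bernoulli_sup (K : {set Y}) :
  \sum_(U : {set Y} | K \subset U) bernoulli U = p ^+ #|K|.
Proof.
transitivity (\prod_y (p + (if y \in K then 0 else 1 - p))).
  rewrite bigA_distr [RHS](bigID (fun U : {set Y} => K \subset U)) /=.
  rewrite [X in _ = _ + X]big1 ?addr0.
    apply: eq_bigr => U sKU; apply: eq_bigr => y _.
    by case: ifP => // /negP yU; case: ifP => // /(subsetP sKU).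
  move=> U /subsetPn[y yK yU]; rewrite (bigD1 y) //=.
  by rewrite (negbTE yU) yK mul0r.
rewrite -prodr_const [RHS]big_mkcond; apply: eq_bigr => y _.
by case: ifP => _; rewrite ?addr0 // addrC subrK.
Qed.

Lemma sum_bernoulli : \sum_U bernoulli U = 1.
Proof.
rewrite -[RHS](expr0 p) -(cards0 Y) -sum_bernoulli_sup.
by apply: eq_bigl => U; rewrite sub0set.
Qed.

(** Exchanging the parts of two independent Bernoulli sets inside K preserves
    their joint law; the three lemmas below are applications. *)
Definition swap_in (K : {set Y}) (W : {set Y} * {set Y}) :=
  ((W.1 :\: K) :|: (W.2 :&: K), (W.2 :\: K) :|: (W.1 :&: K)).

Lemma sum_bernoulli_swap (K : {set Y}) (h : {set Y} -> {set Y} -> R) :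
  \sum_U \sum_U' bernoulli U * bernoulli U' * h U U' =
  \sum_U \sum_U' bernoulli U * bernoulli U' *
     h ((U :\: K) :|: (U' :&: K)) ((U' :\: K) :|: (U :&: K)).
Proof.
rewrite !pair_big /=.
rewrite (reindex_inj (h := swap_in K)) /=; last first.
  apply: (can_inj (g := swap_in K)) => -[U U']; rewrite /swap_in /=.
  by congr (_, _); apply/setP=> y; rewrite !inE;
    case: (y \in U); case: (y \in U'); case: (y \in K).
apply: eq_bigr => -[U U'] _ /=; congr (_ * _).
rewrite /bernoulli -!big_split /=; apply: eq_bigr => y _; rewrite !inE.
by case: (y \in U); case: (y \in U'); case: (y \in K) => //=; rewrite mulrC.
Qed.

(** Forcing the elements of K into a Bernoulli set and paying p for each of them
    is the same as restricting to the sets that contain K. *)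
Lemma sum_bernoulli_force (K : {set Y}) (h : {set Y} -> R) :
  p ^+ #|K| * (\sum_U bernoulli U * h (U :|: K)) =
  \sum_(U : {set Y} | K \subset U) bernoulli U * h U.
Proof.
transitivity (\sum_U \sum_U' bernoulli U * bernoulli U' *
   ((K \subset U')%:R * h (U :|: K))).
  rewrite mulr_sumr; apply: eq_bigr => U _.
  rewrite -sum_bernoulli_sup mulr_suml [RHS](bigID (fun U' : {set Y} => K \subset U')) /=.
  rewrite [X in _ = _ + X]big1 ?addr0; last by move=> U' /negbTE ->; rewrite mul0r mulr0.
  by apply: eq_bigr => U' ->; rewrite mul1r; ring.
rewrite (sum_bernoulli_swap K) [RHS]big_mkcond /=; apply: eq_bigr => U _.
transitivity (\sum_U' bernoulli U' * (bernoulli U * ((K \subset U)%:R * h U))); last first.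
  by rewrite -mulr_suml sum_bernoulli mul1r; case: ifP => _; rewrite ?mul1r ?mul0r ?mulr0.
apply: eq_bigr => U' _; rewrite (mulrC (bernoulli U)) -mulrA.
congr (_ * (_ * _)).
have -> : (K \subset U' :\: K :|: U :&: K) = (K \subset U).
  apply/subsetP/subsetP => s y yK; have := s y yK; rewrite !inE yK /=.
    by rewrite andbT.
  by move=> ->.
have [sKU|_] := boolP (K \subset U); last by rewrite !mul0r.
congr (_ * h _); apply/setP=> y; rewrite !inE.
have := subsetP sKU y.
by case: (y \in K); case: (y \in U); case: (y \in U') => //= /(_ isT).
Qed.

(** A Bernoulli set may be resampled independently on disjoint parts of Y. *)
Lemma sum_bernoulli_indep (K K' : {set Y}) (h : {set Y} -> {set Y} -> R) :
  [disjoint K & K'] ->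
  \sum_U bernoulli U * h (U :&: K) (U :&: K') =
  \sum_U \sum_U' bernoulli U * bernoulli U' * h (U :&: K) (U' :&: K').
Proof.
move=> dK; rewrite (sum_bernoulli_swap K'); apply: eq_bigr => U _.
transitivity (\sum_U' bernoulli U' * (bernoulli U * h (U :&: K) (U :&: K'))).
  by rewrite -mulr_suml sum_bernoulli mul1r.
apply: eq_bigr => U' _; rewrite mulrA (mulrC (bernoulli U)); congr (_ * h _ _);
  apply/setP=> y; rewrite !inE.
  have [yK|_] := boolP (y \in K); last by rewrite !andbF.
  by rewrite (disjointFr dK yK) andbF orbF.
by case: (y \in K'); rewrite ?andbF ?andbT //= orbF.
Qed.

Lemma bernoulli_modular (U U' : {set Y}) :
  bernoulli U * bernoulli U' = bernoulli (U :|: U') * bernoulli (U :&: U').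
Proof.
rewrite /bernoulli -!big_split /=; apply: eq_bigr => y _; rewrite !inE.
by case: (y \in U); case: (y \in U') => //=; rewrite mulrC.
Qed.

End Bernoulli.

(** * Functions constant along a relation *)

Lemma bool_addE (a b : bool) : a + b = a (+) b. Proof. by []. Qed.

(** Spin configurations are functions to bool, seen as the field with two
    elements; [flat e] is the vector space of those that vanish on D and are
    constant along the relation e. *)
Section Flat.
Context (F : finType) (D : {set F}).

Definition flat (e : rel F) : {set {ffun F -> bool}} :=
  [set t : {ffun F -> bool} | [forall u in D, ~~ t u] &&
     [forall u, forall v, e u v ==> (t u == t v)]].

Lemma flatP (e : rel F) (t : {ffun F -> bool}) :
  reflect ((forall u, u \in D -> t u = false) /\ (forall u v, e u v -> t u = t v))
          (t \in flat e).
Proof.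
rewrite inE; apply: (iffP andP) => [[/forall_inP tD /forallP te]|[tD te]]; split.
- by move=> u /tD /negbTE.
- by move=> u v /(implyP (forallP (te u) v)) /eqP.
- by apply/forall_inP => u /tD ->.
- by apply/'forall_forallP => u v; apply/implyP => /te ->.
Qed.

Lemma eq_flat (e1 e2 : rel F) : e1 =2 e2 -> flat e1 = flat e2.
Proof.
move=> e; apply/setP => t; rewrite !inE; congr (_ && _).
by apply: eq_forallb => u; apply: eq_forallb => v; rewrite e.
Qed.

Lemma flatD (e1 e2 e : rel F) (s t : {ffun F -> bool}) :
  (forall u v, e u v -> e1 u v && e2 u v) ->
  s \in flat e1 -> t \in flat e2 -> s + t \in flat e.
Proof.
move=> h /flatP[sD se] /flatP[tD te]; apply/flatP; split=> [u uD|u v /h/andP[/se + /te]].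
  by rewrite ffunE sD // tD.
by rewrite !ffunE => -> ->.
Qed.

Lemma flat_sup (e1 e2 e : rel F) (s t s' t' : {ffun F -> bool}) :
  (forall u v, e u v -> e1 u v || e2 u v) ->
  s \in flat e1 -> s' \in flat e1 -> t \in flat e2 -> t' \in flat e2 ->
  s + t = s' + t' -> s + s' \in flat e.
Proof.
move=> h s1 s1' t2 t2' st.
have ss : s + s' = t + t'.
  apply/ffunP => u; move/ffunP/(_ u): st; rewrite !ffunE.
  by case: (s u); case: (t u); case: (s' u); case: (t' u).
have /flatP[sD se] : s + s' \in flat e1.
  by apply: (@flatD e1 e1) => // u v ->.
have /flatP[_ te] : t + t' \in flat e2.
  by apply: (@flatD e2 e2) => // u v ->.
apply/flatP; split => // u v /h/orP[/se //|]; by rewrite ss => /te.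
Qed.

Lemma mem_setX (T : finType) (A B : {set T}) w :
  (w \in setX A B) = (w.1 \in A) && (w.2 \in B).
Proof. by case: w => a b; rewrite in_setX. Qed.

(** This is #|V| #|W| = #|V + W| #|V :&: W| for the two spaces on the left.  The
    injection sends a pair with sum z to z and to the difference of its first
    component with that of a pair chosen once and for all among those of sum z. *)
Lemma card_flat_supermodular (e1 e2 e3 e4 : rel F) :
  (forall u v, e3 u v -> e1 u v && e2 u v) ->
  (forall u v, e4 u v -> e1 u v || e2 u v) ->
  (#|flat e1| * #|flat e2| <= #|flat e3| * #|flat e4|)%N.
Proof.
move=> h3 h4.
pose T := {ffun F -> bool}.
pose W := setX (flat e1) (flat e2).
pose rep (s : T) : T * T := odflt (0, 0) [pick w in W | w.1 + w.2 == s].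
have repP w : w \in W -> (rep (w.1 + w.2) \in W) /\
    (rep (w.1 + w.2)).1 + (rep (w.1 + w.2)).2 = w.1 + w.2.
  move=> wW; rewrite /rep; case: pickP => [w' /andP[w'W /eqP //]|/(_ w)].
  by rewrite wW eqxx.
pose code (w : T * T) := (w.1 + w.2, w.1 + (rep (w.1 + w.2)).1).
rewrite -!cardsX -/W -(card_in_imset (f := code)).
  apply/subset_leq_card/subsetP => _ /imsetP[w wW ->].
  have [rW rs] := repP _ wW; move: wW rW; rewrite !mem_setX.
  move=> /andP[w1 w2] /andP[r1 r2]; apply/andP; split => /=.
    exact: flatD h3 w1 w2.
  exact: (flat_sup h4 w1 r1 w2 r2 (esym rs)).
move=> [a b] [a' b'] _ _ [/= eS]; rewrite eS => /addIr eA.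
by move: eS; rewrite eA => /addrI ->.
Qed.

(** The equality case of the supermodularity: the sum of the spaces of e1 and e2 is
    the whole space of e3. *)
Lemma card_flat_split (e1 e2 e3 e4 : rel F) :
  (forall u v, e3 u v -> e1 u v && e2 u v) ->
  (forall u v, e1 u v || e2 u v = e4 u v) ->
  (forall t, t \in flat e3 -> exists2 a, a \in flat e1 & t + a \in flat e2) ->
  (#|flat e3| * #|flat e4| = #|flat e1| * #|flat e2|)%N.
Proof.
move=> h3 h4 split3; apply/eqP; rewrite eqn_leq; apply/andP; split; last first.
  by apply: card_flat_supermodular => // u v; rewrite h4.
pose T := {ffun F -> bool}.
pose part (t : T) : T := odflt 0 [pick a in flat e1 | t + a \in flat e2].
have partP t : t \in flat e3 -> part t \in flat e1 /\ t + part t \in flat e2.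
  move=> t3; rewrite /part; case: pickP => [a /andP[] //|na].
  by have [a a1 a2] := split3 t t3; have := na a; rewrite a1 a2.
pose code (w : T * T) := (part w.1 + w.2, w.1 + part w.1 + w.2).
rewrite -!cardsX -(card_in_imset (f := code)).
  apply/subset_leq_card/subsetP => w /imsetP[[t i]]; rewrite mem_setX /=.
  move=> /andP[/partP[p1 p2] i4] ->; rewrite mem_setX /=; apply/andP; split.
    by apply: (flatD _ p1 i4) => u v e; rewrite e -h4 e.
  by apply: (flatD _ p2 i4) => u v e; rewrite e -h4 e orbT.
move=> [t i] [t' i'] _ _ [] /= e1E e2E.
have tt : t = t' by move: e2E; rewrite -!addrA e1E => /addIr.
by move: e1E; rewrite tt => /addrI ->.
Qed.
End Flat.

(** * A spin model on an abstract graph *)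

(** The model on a graph whose vertices are the faces: y is surrounded by the
    clique N y, and the second colour is pinned to b on D (an empty D means a free
    boundary condition). *)
Section Model.
Context (R : realFieldType) (F Y : finType) (adj : rel F) (N : Y -> {set F}).
Context (D : {set F}) (b : bool) (p : R).

Hypothesis p_gt0 : 0 < p.
Hypothesis p_le1 : p <= 1.
Hypothesis N_clique : forall y u v, u \in N y -> v \in N y -> u != v -> adj u v.
Hypothesis N_neq0 : forall y, N y != set0.
(** The only planar input: the variation of t inside the + region of s is the
    variation of a function. *)
Hypothesis splitting : forall s t : {ffun F -> bool},
  (forall u v, adj u v -> s u != s v -> t u = t v) ->
  (forall u, u \in D -> t u = false) ->
  exists2 a : {ffun F -> bool},
    forall u v, adj u v -> a u (+) a v = [&& s u, s v & t u (+) t v] &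
    forall u, u \in D -> a u = false.

Local Notation spin := {ffun F -> bool}.

Definition inside (A : {set F}) : {set Y} := [set y | N y \subset A].

(** The set of y around which the configuration with + set A is not constant. *)
Definition mixed (A : {set F}) : {set Y} := ~: (inside A :|: inside (~: A)).

Definition plus (s : spin) : {set F} := [set u | s u].

Definition agree (s t : spin) :=
  [forall u, forall v, adj u v ==> (s u == s v) || (t u == t v)].

Definition pair_weight (s t : spin) : R :=
  if agree s t then p ^+ #|mixed (plus s) :|: mixed (plus t)| else 0.

Definition pinned (t : spin) := [forall u in D, t u == b].

(** The percolation of the colour s, when U is the set of vertices that are open
    by chance. *)
Definition perco (s t : spin) (U : {set Y}) : {set Y} :=
  (U :|: mixed (plus t)) :\: mixed (plus s).

(** The equations on the component of the second colour that varies only inside A: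
    a vertex imposes none when it is surrounded by A and open. *)
Definition tied (A : {set F}) (U : {set Y}) : rel F := fun u v =>
  (adj u v && ~~ ((u \in A) && (v \in A))) ||
  [exists y, [&& u \in N y, v \in N y & ~~ ((y \in U) && (N y \subset A))]].

(** The equations on the second colour itself, given the percolation and the first
    colour, whose + set is A. *)
Definition tied_sides (A : {set F}) (U : {set Y}) : rel F := fun u v =>
  (adj u v && ((u \in A) != (v \in A))) ||
  [exists y, [&& u \in N y, v \in N y &
     ~~ ((y \in U) && ((N y \subset A) || (N y \subset ~: A)))]].

Definition tied_all : rel F := fun u v =>
  adj u v || [exists y, (u \in N y) && (v \in N y)].

Notation fl e := (flat D e).

Lemma tied_lattice (A B : {set F}) (U V : {set Y}) :
  (#|fl (tied A U)| * #|fl (tied B V)| <=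
   #|fl (tied (A :|: B) (U :|: V))| * #|fl (tied (A :&: B) (U :&: V))|)%N.
Proof.
apply: (@card_flat_supermodular _ D (tied A U) (tied B V)) => u v.
  rewrite {1}/tied => /orP[/andP[auv nAB]|/existsP[y /and3P[yu yv nAB]]].
    apply/andP; split; apply/orP; left; rewrite auv; apply: contra nAB;
      by rewrite !inE => /andP[-> ->]; rewrite ?orbT.
  apply/andP; split; apply/orP; right; apply/existsP; exists y; rewrite yu yv;
    apply: contra nAB => /andP[yU sN]; rewrite inE yU ?orbT /=.
    exact: subset_trans sN (subsetUl _ _).
  exact: subset_trans sN (subsetUr _ _).
rewrite {1}/tied => /orP[/andP[auv]|/existsP[y /and3P[yu yv]]].
  rewrite !inE => nAB; rewrite /tied auv /=.
  by move: nAB; case: (u \in A); case: (v \in A); case: (u \in B);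
    case: (v \in B) => //=; rewrite ?orbT.
rewrite !inE subsetI => nAB; apply/orP.
have [yA|yA] := boolP ((y \in U) && (N y \subset A)).
  right; apply/orP; right; apply/existsP; exists y; rewrite yu yv /=.
  by apply: contra nAB => /andP[-> ->]; case/andP: yA => -> ->.
by left; apply/orP; right; apply/existsP; exists y; rewrite yu yv.
Qed.

Lemma tied_inside A U : fl (tied A (U :&: inside A)) = fl (tied A U).
Proof.
have e u v : tied A (U :&: inside A) u v = tied A U u v.
  rewrite /tied; congr (_ || _); apply: eq_existsb => y.
  by rewrite !inE -andbA andbb.
exact: eq_flat.
Qed.

Lemma not_subset_compl y u (A : {set F}) :
  u \in N y -> u \in A -> (N y \subset ~: A) = false.
Proof. by move=> uy uA; apply/negbTE/subsetPn; exists u; rewrite // inE uA. Qed.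

(** The component inside A is provided by [splitting].  The two kinds of
    component meet in the functions constant along every edge, whatever A is. *)
Lemma tied_split A U :
  (#|fl (tied_sides A U)| * #|fl tied_all| = #|fl (tied A U)| * #|fl (tied (~: A) U)|)%N.
Proof.
apply: (@card_flat_split _ D (tied A U) (tied (~: A) U)).
- move=> u v; rewrite /tied_sides => /orP[/andP[auv uv]|/existsP[y /and3P[yu yv n]]].
    rewrite /tied auv !inE /=.
    by move: uv; case: (u \in A); case: (v \in A).
  apply/andP; split; apply/orP; right; apply/existsP; exists y; rewrite yu yv;
    by apply: contra n => /andP[-> ->]; rewrite ?orbT.
- move=> u v; rewrite /tied /tied_all !inE.
  have [auv|nauv] /= := boolP (adj u v).
    by case: (u \in A); case: (v \in A); rewrite //= ?orbT.
  apply/orP/existsP => [[]/existsP[y /and3P[yu yv _]]|[y /andP[yu yv]]];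
    try by exists y; rewrite yu yv.
  have [yA|nyA] := boolP (N y \subset A); last first.
    by left; apply/existsP; exists y; rewrite yu yv (negbTE nyA) andbF.
  right; apply/existsP; exists y; rewrite yu yv (@not_subset_compl y u) ?andbF //.
  exact: (subsetP yA).
- move=> t /flatP[tD te].
  have [u v auv|//|a ae aD] := splitting (s := [ffun u => u \in A]) (t := t).
    by rewrite !ffunE => uv; apply: te; rewrite /tied_sides auv uv.
  have {}ae u v : adj u v -> a u (+) a v = [&& u \in A, v \in A & t u (+) t v].
    by move=> /ae; rewrite !ffunE.
  have eqa u v : ~~ (a u (+) a v) -> a u = a v by case: (a u); case: (a v).
  have ty y u v : u \in N y -> v \in N y ->
      (y \notin U) || ~~ (N y \subset A) && ~~ (N y \subset ~: A) -> t u = t v.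
    move=> yu yv h; apply: te; apply/orP; right; apply/existsP; exists y.
    by rewrite yu yv negb_and negb_or.
  exists a; apply/flatP; split => //.
  + move=> u v; rewrite /tied => /orP[/andP[auv nuv]|/existsP[y /and3P[yu yv n]]].
      by apply: eqa; rewrite ae // andbA (negbTE nuv).
    have [-> //|uv] := eqVneq u v.
    have auv := N_clique yu yv uv.
    apply: eqa; rewrite ae //; apply/negP => /and3P[uA vA].
    suff -> : t u = t v by rewrite addbb.
    apply: (ty y) => //; move: n.
    by rewrite negb_and (not_subset_compl yu uA) andbT.
  + by move=> u uD; rewrite ffunE tD // aD.
  + have tae u v : adj u v -> ~~ ((u \in ~: A) && (v \in ~: A)) -> (t + a) u = (t + a) v.
      move=> auv; rewrite !inE !ffunE !bool_addE => n; have := ae _ _ auv.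
      have : ((u \in A) != (v \in A)) -> t u = t v.
        by move=> uv; apply: te; rewrite /tied_sides auv uv.
      by move: n; case: (u \in A); case: (v \in A) => //= _;
        case: (t u); case: (t v); case: (a u); case: (a v) => //= /(_ isT).
    move=> u v; rewrite /tied => /orP[/andP[auv nuv]|/existsP[y /and3P[yu yv n]]].
      exact: tae.
    have [-> //|uv] := eqVneq u v.
    have auv := N_clique yu yv uv.
    have [uvA|] := boolP ((u \in ~: A) && (v \in ~: A)); last exact: tae.
    rewrite !ffunE.
    case/andP: uvA => uA vA.
    have -> : t u = t v.
      apply: (ty y) => //; move: n; rewrite negb_and.
      by have := not_subset_compl yu uA; rewrite setCK => ->.
    congr (_ + _); apply: eqa; rewrite ae //.
    by rewrite inE in uA; rewrite (negbTE uA).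
Qed.

Lemma mixedPn y (s : spin) :
  reflect (forall u v, u \in N y -> v \in N y -> s u = s v) (y \notin mixed (plus s)).
Proof.
rewrite !inE negbK; apply: (iffP orP) => [[] /subsetP sN u v /sN + /sN|h].
- by rewrite !inE => -> ->.
- by rewrite !inE => /negbTE -> /negbTE ->.
- have /set0Pn[u0 u0y] := N_neq0 y.
  case e : (s u0); [left|right]; apply/subsetP => u uy; rewrite !inE;
    by rewrite (h u u0) // e.
Qed.

(** The faces around y are pairwise adjacent, so if s separates two of them then
    each of the others is separated by s from one of the two, and t is constant. *)
Lemma agree_disjoint s t : agree s t -> [disjoint mixed (plus s) & mixed (plus t)].
Proof.
move=> /'forall_forallP st; apply/pred0P => y /=; apply/negbTE/negP => /andP[ys yt].
have st' u v : u \in N y -> v \in N y -> s u != s v -> t u = t v.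
  move=> yu yv suv; have uv : u != v by apply: contra suv => /eqP ->.
  by have := st u v; rewrite (N_clique yu yv uv) (negbTE suv) => /eqP.
move: yt; apply/negP/mixedPn => u v yu yv; apply/eqP.
apply: contraLR ys => tuv; apply/mixedPn.
have suv : s u = s v by apply/eqP; apply: contraNT tuv => /(st' _ _ yu yv) ->.
suff H w : w \in N y -> s w = s u by move=> w w' /H -> /H ->.
move=> yw; apply/eqP; apply: contraNT tuv => swu.
rewrite -(st' w u yw yu swu); apply/eqP; apply: st' => //.
by rewrite -suv.
Qed.

(** Adding b everywhere turns the boundary value b into 0, hence the affine space
    of admissible t into a vector space. *)
Lemma flat_tied_sidesE s t U :
  ((t + [ffun=> b]) \in fl (tied_sides (plus s) U)) =
  [&& pinned t, agree s t & mixed (plus t) \subset U].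
Proof.
have tb u v : ((t + [ffun=> b]) u == (t + [ffun=> b]) v) = (t u == t v).
  by rewrite !ffunE; case: (t u); case: (t v); case: b.
apply/flatP/and3P => [[tD te]|[/forall_inP tD st tU]].
- have {}te u v : tied_sides (plus s) U u v -> t u = t v.
    by move=> /te /eqP; rewrite tb => /eqP.
  have ag : agree s t.
    apply/'forall_forallP => u v; apply/implyP => auv; rewrite orbC -implyNb.
    apply/implyP/contraR => suv; apply/eqP/te; rewrite /tied_sides auv !inE.
    by rewrite suv.
  split => //.
    apply/forall_inP => u /tD; rewrite !ffunE.
    by case: (t u); case: b.
  apply/subsetP => y; apply: contraLR => yU; apply/mixedPn => u v yu yv.
  apply: te; apply/orP; right; apply/existsP; exists y.
  by rewrite yu yv (negbTE yU).
- split=> [u /tD/eqP|u v]; first by rewrite !ffunE => ->; case: b.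
  rewrite /tied_sides => /orP[/andP[auv]|/existsP[y /and3P[yu yv]]].
    rewrite !inE => suv; apply/eqP; rewrite tb.
    by have /'forall_forallP/(_ u v) := st; rewrite auv (negbTE suv).
  move=> n; apply/eqP; rewrite tb; apply/eqP.
  suff : y \notin mixed (plus t) by move/mixedPn; apply.
  move: n; rewrite negb_and => /orP[yU|ys].
    by apply: contra yU; apply: (subsetP tU).
  by rewrite (disjointFr (agree_disjoint st)) // !inE.
Qed.

(** Summing over the second colour: the vertices where it is not constant carry a
    weight p each and are forced into the percolation, so [sum_bernoulli_force]
    absorbs both effects into the Bernoulli set. *)
Lemma sum_other_colour s (h : {set Y} -> R) :
  \sum_(t | pinned t) pair_weight s t * (\sum_U bernoulli p U * h (perco s t U)) =
  p ^+ #|mixed (plus s)| *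
  \sum_U bernoulli p U * #|fl (tied_sides (plus s) U)|%:R * h (U :\: mixed (plus s)).
Proof.
set M := mixed (plus s).
transitivity (\sum_(t | pinned t) \sum_U p ^+ #|M| * bernoulli p U *
    (agree s t && (mixed (plus t) \subset U))%:R * h (U :\: M)).
  apply: eq_bigr => t _; rewrite /pair_weight; case: ifP => [st|_]; last first.
    by rewrite mul0r big1 // => U _; rewrite mulr0 mul0r.
  have dM := agree_disjoint st.
  rewrite cardsU disjoint_setI0 // cards0 subn0 exprD -mulrA.
  rewrite (sum_bernoulli_force p (mixed (plus t)) (fun U => h (U :\: M))).
  rewrite mulr_sumr big_mkcond /=; apply: eq_bigr => U _.
  by case: ifP => _; rewrite ?mulr1 ?mulr0 ?mul0r ?mulrA.
rewrite exchange_big mulr_sumr /=; apply: eq_bigr => U _.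
rewrite -mulr_suml -mulr_sumr -!mulrA; congr (_ * (_ * (_ * _))).
rewrite -natr_sum; congr (_%:R).
rewrite -sum1_card [RHS](reindex_inj (addIr [ffun=> b])) /= big_mkcond [RHS]big_mkcond /=.
apply: eq_bigr => t _; rewrite flat_tied_sidesE.
by case: (pinned t); case: (agree s t && _).
Qed.

(** The weight of (A, U, V), where U and V are the independent Bernoulli sets that
    govern the percolation inside A and inside its complement. *)
Definition density (A : {set F}) (U V : {set Y}) : R :=
  p ^+ #|mixed A| * (bernoulli p U * bernoulli p V) *
  (#|fl (tied A U)|%:R * #|fl (tied (~: A) V)|%:R).

Lemma density_ge0 A U V : 0 <= density A U V.
Proof.
have p01 : 0 <= p <= 1 by rewrite ltW.
by rewrite /density !mulr_ge0 ?exprn_ge0 ?bernoulli_ge0 ?ler0n // ltW.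
Qed.

Lemma card_mixed_submod A B :
  (#|mixed (A :|: B)| + #|mixed (A :&: B)| <= #|mixed A| + #|mixed B|)%N.
Proof.
rewrite -cardsUI -[leqRHS]cardsUI.
have s1 : inside A :&: inside B = inside (A :&: B).
  by apply/setP => y; rewrite !inE subsetI.
have s2 : inside A :|: inside B \subset inside (A :|: B).
  by apply/subsetP => y; rewrite !inE => /orP[] /subset_trans->;
    rewrite ?subsetUl ?subsetUr.
have s3 : inside (~: A) :&: inside (~: B) = inside (~: (A :|: B)).
  by apply/setP => y; rewrite !inE setCU subsetI.
have s4 : inside (~: A) :|: inside (~: B) \subset inside (~: (A :&: B)).
  by apply/subsetP => y; rewrite !inE setCI => /orP[] /subset_trans->;
    rewrite ?subsetUl ?subsetUr.
apply: leq_add; apply/subset_leq_card/subsetP => y;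
  have /implyP := subsetP s2 y; have /implyP := subsetP s4 y;
  rewrite /mixed -s1 -s3 !inE;
  move: (N y \subset A) (N y \subset B) (N y \subset ~: A) (N y \subset ~: B)
    (N y \subset A :|: B) (N y \subset ~: (A :&: B)); by do 6 case.
Qed.

Lemma density_lattice A U V A' U' V' :
  density A U V * density A' U' V' <=
  density (A :|: A') (U :|: U') (V :&: V') * density (A :&: A') (U :&: U') (V :|: V').
Proof.
rewrite /density mulrACA [leRHS]mulrACA.
have p01 : 0 <= p <= 1 by rewrite p_le1 ltW.
apply: ler_pM.
- by do 2 apply: mulr_ge0; rewrite ?exprn_ge0 ?mulr_ge0 ?bernoulli_ge0 // ltW.
- by rewrite !mulr_ge0.
- rewrite mulrACA [leRHS]mulrACA; apply: ler_pM.
  + by rewrite mulr_ge0 // exprn_ge0 // ltW.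
  + by rewrite !mulr_ge0 ?bernoulli_ge0.
  + rewrite -!exprD; apply: ler_wiXn2l => //; first exact: ltW.
    exact: card_mixed_submod.
  + by rewrite mulrACA (bernoulli_modular p U) (bernoulli_modular p V)
       [leRHS]mulrACA (mulrC (bernoulli p (V :&: V'))).
- rewrite mulrACA [leRHS]mulrACA; apply: ler_pM; rewrite ?mulr_ge0 //.
    by rewrite -!natrM ler_nat tied_lattice.
  rewrite setCU setCI [leRHS]mulrC -!natrM ler_nat.
  exact: tied_lattice.
Qed.

Definition spin_mass (Q : pred {set F}) (f : {set F} -> {set Y} -> {set Y} -> R) : R :=
  \sum_(s | Q (plus s)) \sum_(t | pinned t) pair_weight s t *
    \sum_U bernoulli p U * f (plus s) (perco s t U :&: inside (plus s))
                                 (perco s t U :&: inside (~: plus s)).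

Lemma plus_bij : bijective plus.
Proof.
exists (fun A : {set F} => [ffun u => u \in A]) => [s|A].
  by apply/ffunP => u; rewrite ffunE inE.
by apply/setP => u; rewrite inE ffunE.
Qed.

(** Up to the constant #|fl tied_all|, the mass of (A, U, V) is [density]:
    [tied_split] separates the two signs, and [sum_bernoulli_indep] gives each its
    own Bernoulli set since no vertex is surrounded by both signs. *)
Lemma spin_massE (Q : pred {set F}) f :
  #|fl tied_all|%:R * spin_mass Q f =
  mass3 (fun A U V => (Q A)%:R * density A U V)
        (fun A U V => f A (U :&: inside A) (V :&: inside (~: A))).
Proof.
rewrite /spin_mass /mass3 (reindex plus) /=; last exact: onW_bij plus_bij.
rewrite mulr_sumr big_mkcond; apply: eq_bigr => s _.
case: ifP => _; last first.
  by rewrite big1 // => U _; rewrite big1 // => V _; rewrite !mul0r.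
set A := plus s; pose h W := f A (W :&: inside A) (W :&: inside (~: A)).
rewrite (sum_other_colour s h) -/A.
have dI : [disjoint inside A & inside (~: A)].
  apply/pred0P => y /=; apply/negbTE; rewrite !inE.
  have /set0Pn[u uy] := N_neq0 y.
  by apply/negP => /andP[/subsetP/(_ u uy) uA /subsetP/(_ u uy)]; rewrite inE uA.
pose k U V : R := #|fl (tied A U)|%:R * #|fl (tied (~: A) V)|%:R * f A U V.
transitivity (p ^+ #|mixed A| *
    \sum_U bernoulli p U * k (U :&: inside A) (U :&: inside (~: A))).
  rewrite mulrCA; congr (_ * _); rewrite mulr_sumr; apply: eq_bigr => U _.
  rewrite /k !tied_inside -natrM -tied_split natrM /h.
  rewrite (_ : (U :\: mixed A) :&: inside A = U :&: inside A); last first.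
    by apply/setP => y; rewrite !inE; case: (N y \subset A); rewrite ?andbF.
  rewrite (_ : (U :\: mixed A) :&: inside (~: A) = U :&: inside (~: A)); last first.
    by apply/setP => y; rewrite !inE; case: (N y \subset ~: A); rewrite ?andbF ?orbT.
  by ring.
rewrite (sum_bernoulli_indep p k dI) mulr_sumr; apply: eq_bigr => U _.
rewrite mulr_sumr; apply: eq_bigr => V _.
by rewrite /k /density !tied_inside mul1r; ring.
Qed.

Lemma model_fkg (Q : pred {set F}) (f g : {set F} -> {set Y} -> {set Y} -> R) :
  (forall A B, Q A -> Q B -> Q (A :|: B) && Q (A :&: B)) ->
  increasing3 f -> increasing3 g ->
  spin_mass Q f * spin_mass Q g <=
  spin_mass Q (fun A U V => f A U V * g A U V) * spin_mass Q (fun _ _ _ => 1).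
Proof.
move=> QQ fi gi.
have c0 : 0 < #|fl tied_all|%:R :> R.
  rewrite ltr0n card_gt0; apply/set0Pn; exists 0; apply/flatP.
  by split=> *; rewrite !ffunE.
rewrite -(ler_pM2l c0) -(ler_pM2l c0).
rewrite [leLHS](_ : _ = (#|fl tied_all|%:R * spin_mass Q f) *
   (#|fl tied_all|%:R * spin_mass Q g)); last by ring.
rewrite [leRHS](_ : _ =
   (#|fl tied_all|%:R * spin_mass Q (fun A U V => f A U V * g A U V)) *
   (#|fl tied_all|%:R * spin_mass Q (fun _ _ _ => 1))); last by ring.
rewrite !spin_massE; apply: fkg_three_sets.
- by move=> A U V; rewrite mulr_ge0 ?density_ge0.
- move=> A U V A' U' V'; rewrite mulrACA [leRHS]mulrACA.
  apply: ler_pM; [exact: mulr_ge0|by apply: mulr_ge0; exact: density_ge0| |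
    exact: density_lattice].
  have := QQ A A'; case: (Q A); case: (Q A') => QAA; rewrite ?mul0r ?mulr0 ?mulr_ge0 //.
  by have /andP[-> ->] := QAA isT isT.
- move=> A A' U U' V V' sA sU sV; apply: fi => //.
    by apply: setISS => //; apply/subsetP => y; rewrite !inE => /subset_trans; apply.
  by apply: setISS => //; apply/subsetP => y; rewrite !inE => /subset_trans; apply; rewrite setCS.
- move=> A A' U U' V V' sA sU sV; apply: gi => //.
    by apply: setISS => //; apply/subsetP => y; rewrite !inE => /subset_trans; apply.
  by apply: setISS => //; apply/subsetP => y; rewrite !inE => /subset_trans; apply; rewrite setCS.
Qed.
End Model.

(** * The triangular lattice of faces: neighbours and boxes *)

Definition fshift (w d : face) : face := (w.1 + d.1, w.2 + d.2).
Definition fdiff (v w : face) : face := (v.1 - w.1, v.2 - w.2).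
(** The rotation by a sixth of a turn in the coordinates (1, e^(i pi/3)). *)
Definition turn60 (d : face) : face := (- d.2, d.1 + d.2).
Definition dirs : seq face := [:: (1, 0); (0, 1); (-1, 1); (-1, 0); (0, -1); (1, -1)].

Lemma fadjE u v : fadj u v = (fdiff v u \in dirs). Proof. by []. Qed.

Lemma fshiftK w v : fshift w (fdiff v w) = v.
Proof. by case: v => a b; rewrite /fshift /fdiff /= !subrKC. Qed.

Lemma fdiff_shift2 w d d' : fdiff (fshift w d) (fshift w d') = fdiff d d'.
Proof. by rewrite /fshift /fdiff /=; congr pair; ring. Qed.

Lemma fadj_sym u v : fadj u v = fadj v u.
Proof.
have h a b : fadj a b -> fadj b a.
  rewrite !fadjE => h.
  rewrite -[fdiff a b](_ : fshift (0, 0) (iter 3 turn60 (fdiff b a)) = _).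
    by move: (fdiff b a) h; apply/allP.
  by rewrite /fdiff /fshift /turn60 /=; congr pair; ring.
by apply/idP/idP => /h.
Qed.

Definition ring6 (d : face) : seq face := [seq iter i turn60 d | i <- iota 0 6].

Lemma ring6_mem d d' : d \in dirs -> d' \in dirs -> d' \in ring6 d.
Proof. by move=> hd; move: d'; apply/allP; move: d hd; apply/allP. Qed.

Lemma ring6_adj d i j : d \in dirs -> (0 < i < 6)%N -> (0 < j < 6)%N ->
  fdiff (iter j turn60 d) (iter i turn60 d) \in dirs -> (j == i.+1) || (i == j.+1).
Proof.
move=> hd hi hj; apply/implyP.
have : all (fun d => all (fun i => all (fun j =>
    (fdiff (iter j turn60 d) (iter i turn60 d) \in dirs) ==> ((j == i.+1) || (i == j.+1)))
  (iota 1 5)) (iota 1 5)) dirs by [].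
by move=> /allP/(_ d hd)/allP/(_ i)/(_ _)/allP; apply; rewrite mem_iota.
Qed.

(** Without z, the six neighbours of w form a path, along which phi can be summed. *)
Lemma fill_ring (phi : rel face) (w z : face) : symmetric phi -> fadj w z ->
  exists s : face -> bool, forall v v', v != z -> v' != z ->
    fadj w v -> fadj w v' -> fadj v v' -> s v (+) s v' = phi v v'.
Proof.
move=> phiC; rewrite fadjE; set d := fdiff z w => hd.
pose t i := fshift w (iter i turn60 d).
pose S i := \big[addb/false]_(1 <= k < i) phi (t k) (t k.+1).
pose pos v := index (fdiff v w) (ring6 d).
exists (fun v => S (pos v)).
have posP v : v != z -> fadj w v -> (0 < pos v < 6)%N /\ v = t (pos v).
  move=> vz; rewrite fadjE => hv.
  have hi := ring6_mem hd hv.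
  have i6 : (pos v < 6)%N by rewrite -index_mem in hi.
  have vE : v = t (pos v).
    rewrite -[LHS](fshiftK w) -(nth_index (0, 0) hi) -/(pos v).
    by rewrite (nth_map 0%N) ?size_iota // nth_iota // add0n.
  split=> //; rewrite i6 andbT lt0n; apply: contraNneq vz => i0.
  by rewrite vE i0 /t /= fshiftK.
move=> v v' vz v'z wv wv'; move: (posP v vz wv) (posP v' v'z wv').
move: (pos v) (pos v') => i j [hi ->] [hj ->].
rewrite fadjE fdiff_shift2 => /(ring6_adj hd hi hj) /orP[]/eqP e.
  rewrite e /S big_nat_recr /=; last by case/andP: hi.
  by rewrite addKb.
rewrite e /S [X in X (+) _]big_nat_recr /=; last by case/andP: hj.
by rewrite addbC addKb phiC.
Qed.

(** Vanishing of the first cohomology with two-element coefficients of the complex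
    formed by G and the edges and triangles of the lattice within G. *)
Definition acyclic (G : {fset face}) := forall phi : rel face, symmetric phi ->
  (forall u v w, u \in G -> v \in G -> w \in G -> fadj u v -> fadj v w -> fadj u w ->
     phi u v (+) phi v w = phi u w) ->
  exists psi : face -> bool, forall u v, u \in G -> v \in G -> fadj u v ->
     psi u (+) psi v = phi u v.

(** A cocycle on G minus w extends to w: [fill_ring] gives its values on the edges
    from w, because a neighbour z of w is missing. *)
Lemma acyclic_rem (G : {fset face}) w z : w \in G -> z \notin G -> fadj w z ->
  acyclic G -> acyclic (G `\ w)%fset.
Proof.
move=> wG zG wz aG phi phiC phi3.
have [s sP] := fill_ring phiC wz.
pose phi' u v := if u == w then s v else if v == w then s u else phi u v.
have fww : fadj w w = false by rewrite fadjE /fdiff !subrr.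
have nez v : v \in G -> v != z by apply: contraTneq => ->.
have [u v|u v x uG vG xG|psi psiP] := aG phi'.
- by rewrite /phi'; case: (eqVneq u w) => [eu|uw]; case: (eqVneq v w) => [ev|vw];
    rewrite ?eu ?ev.
- rewrite /phi'; case: (eqVneq u w) => [eu|uw]; case: (eqVneq v w) => [ev|vw];
  case: (eqVneq x w) => [ex|xw]; rewrite ?eu ?ev ?ex ?fww //.
  + by move=> wv vx wx; rewrite -(sP v x) ?nez // addKb.
  + by move=> uw' wx ux; apply: sP; rewrite ?nez // fadj_sym.
  + move=> uv vw' uw'; rewrite -(sP u v) ?nez // 1?fadj_sym //.
    by rewrite -addbA addbb addbF.
  + by apply: phi3; rewrite !inE ?uw ?vw ?xw.
- exists psi => u v; rewrite !inE => /andP[uw uG] /andP[vw vG] uv.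
  by rewrite psiP // /phi' (negbTE uw) (negbTE vw).
Qed.

Definition grid (m i j : nat) : face := (i%:Z - m%:Z, j%:Z - m%:Z).

Definition box (m : nat) : {fset face} :=
  [fset u in [seq grid m i j | i <- iota 0 m.*2, j <- iota 0 m.*2]]%fset.

Lemma boxP m u : reflect
  (exists i j, [/\ (i < m.*2)%N, (j < m.*2)%N & u = grid m i j]) (u \in box m).
Proof.
rewrite !inE; apply: (iffP allpairsP) => [[[i j]] /=|[i [j [hi hj ->]]]].
  by rewrite !mem_iota => -[hi hj ->]; exists i, j.
by exists (i, j); rewrite !mem_iota.
Qed.

Lemma fadj_grid m i j i' j' : fadj (grid m i j) (grid m i' j') =
  ((i'%:Z - i%:Z, j'%:Z - j%:Z) \in dirs).
Proof. have -> : (i'%:Z - i%:Z, j'%:Z - j%:Z) = fdiff (grid m i' j') (grid m i j).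
  by rewrite /fdiff /grid /=; congr pair; ring.
by []. Qed.

(** A cocycle on a box is summed along the bottom row, then up each column; the
    triangles give the horizontal edges by induction on the height. *)
Lemma acyclic_box m : acyclic (box m).
Proof.
move=> phi phiC phi3.
pose P := grid m; pose n := m.*2.
have PB i j : (i < n)%N -> (j < n)%N -> P i j \in box m.
  by move=> hi hj; apply/boxP; exists i, j.
pose psi i j := (\big[addb/false]_(0 <= a < i) phi (P a 0%N) (P a.+1 0%N)) (+)
  (\big[addb/false]_(0 <= c < j) phi (P i c) (P i c.+1)).
have psiV i j : psi i j (+) psi i j.+1 = phi (P i j) (P i j.+1).
  by rewrite /psi [in X in _ (+) X]big_nat_recr //= addbACA addbb addKb.
have tri_up i j : (i.+1 < n)%N -> (j.+1 < n)%N ->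
    phi (P i j) (P i.+1 j) (+) phi (P i.+1 j) (P i j.+1) = phi (P i j) (P i j.+1).
  move=> hi hj; apply: phi3; try (by apply: PB; lia); rewrite /P fadj_grid.
  - by rewrite -[i.+1]addn1 PoszD subrr addrC addKr.
  - by rewrite -[i.+1]addn1 -[j.+1]addn1 !PoszD opprD addrA addrN add0r addrC addKr.
  - by rewrite -[j.+1]addn1 PoszD subrr addrC addKr.
have tri_dn i j : (i.+1 < n)%N -> (j.+1 < n)%N ->
    phi (P i.+1 j) (P i j.+1) (+) phi (P i j.+1) (P i.+1 j.+1) = phi (P i.+1 j) (P i.+1 j.+1).
  move=> hi hj; apply: phi3; try (by apply: PB; lia); rewrite /P fadj_grid.
  - by rewrite -[i.+1]addn1 -[j.+1]addn1 !PoszD opprD addrA addrN add0r addrC addKr.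
  - by rewrite -[i.+1]addn1 PoszD subrr addrC addKr.
  - by rewrite -[j.+1]addn1 PoszD subrr addrC addKr.
have psiH i j : (i.+1 < n)%N -> (j < n)%N ->
    psi i j (+) psi i.+1 j = phi (P i j) (P i.+1 j).
  move=> hi; elim: j => [|j IH] hj.
    by rewrite /psi !(@big_geq _ _ _ 0 0) // !addbF big_nat_recr //= addKb.
  have := tri_up i j hi hj; have := tri_dn i j hi hj.
  rewrite -psiV -psiV -IH; lia.
have psiD i j : (i.+1 < n)%N -> (j.+1 < n)%N ->
    psi i.+1 j (+) psi i j.+1 = phi (P i.+1 j) (P i j.+1).
  move=> hi hj; have := tri_up i j hi hj; rewrite -psiV -psiH; lia.
exists (fun u : face => psi (absz (u.1 + m%:Z)) (absz (u.2 + m%:Z))) => u v.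
move=> /boxP[i [j [hi hj ->]]] /boxP[i' [j' [hi' hj' ->]]].
rewrite /grid /= !subrK !absz_nat -!/(grid m _ _) fadj_grid !inE !xpair_eqE.
move=> h.
have {h} [[e1 e2]|[[e1 e2]|[[e1 e2]|[[e1 e2]|[[e1 e2]|[e1 e2]]]]]] :
  (i' = i.+1 /\ j' = j) \/ (i' = i /\ j' = j.+1) \/ (i = i'.+1 /\ j' = j.+1) \/
  (i = i'.+1 /\ j' = j) \/ (i' = i /\ j = j'.+1) \/ (i' = i.+1 /\ j = j'.+1) by lia.
all: subst; rewrite -/(P _ _).
- exact: psiH.
- exact: psiV.
- exact: psiD.
- by rewrite addbC phiC; apply: psiH.
- by rewrite addbC phiC; apply: psiV.
- by rewrite addbC phiC; apply: psiD.
Qed.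

From mathcomp Require Import all_classical.

(** * Splitting a configuration along the boundary of a domain *)

Lemma path_exit (G : {fset face}) (e : rel face) u p : path e u p -> u \in G ->
  last u p \notin G ->
  exists w z, [/\ w \in u :: p, w \in G, z \notin G & e w z].
Proof.
elim: p u => [|v p IH] u /=; first by move=> _ ->.
case/andP=> uv pv uG lG; have [vG|vG] := boolP (v \in G).
  have [w [z [wp wG zG wz]]] := IH v pv vG lG.
  by exists w, z; split; rewrite // in_cons wp orbT.
by exists u, v; rewrite mem_head.
Qed.

(** F is reached from B by removing one face at a time, each next to a face that is
    already absent: such a face is found where a path from a face to be removed
    first leaves the current set. *)
Lemma acyclic_no_hole (B F : {fset face}) : acyclic B -> {subset F <= B} ->
  (forall u, u \notin F -> exists p, [/\ path fadj u p,
     {in u :: p, forall w, w \notin F} & last u p \notin B]) ->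
  acyclic F.
Proof.
move=> aB FB hF.
suff H n (G : {fset face}) : (#|` (G `\` F)%fset | < n)%N -> {subset F <= G} ->
    {subset G <= B} -> acyclic G -> acyclic F.
  exact: (H _ B (leqnn _)).
elim: n G => // n IH G; rewrite ltnS => cG FG GB aG.
have [GF0|[u]] := fset_0Vmem (G `\` F)%fset.
  suff <- : G = F by [].
  apply/eqP; rewrite eqEfsubset -fsetD_eq0 GF0 eqxx.
  exact/fsubsetP.
rewrite inE => /andP[uF uG].
have [p [pp pF lB]] := hF u uF.
have [w [z [wp wG zG wz]]] := path_exit pp uG (contra (GB _) lB).
have wF := pF w wp.
apply: (IH (G `\ w)%fset).
- apply: leq_trans cG; apply: fproper_ltn_card; rewrite fsetDDl fsetUC -fsetDDl.
  by apply: fproperD1; rewrite inE wF.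
- by move=> x xF; rewrite !inE FG // andbT; apply: contraTneq xF => ->.
- by move=> x; rewrite !inE => /andP[_ /GB].
- exact: acyclic_rem wG zG wz aG.
Qed.

Lemma box_sup (F : {fset face}) : exists m, {subset F <= box m}.
Proof.
exists (\sum_(u <- F) (absz u.1 + absz u.2)).+1 => u uF; apply/boxP.
have : (absz u.1 + absz u.2 <= \sum_(u <- F) (absz u.1 + absz u.2))%N.
  by rewrite (big_fsetD1 u) //= leq_addr.
move: (\sum_(u <- F) _)%N => m um.
exists (absz (u.1 + m.+1%:Z)), (absz (u.2 + m.+1%:Z)); case: u um {uF} => a b /= um.
split; [lia|lia|rewrite /grid; congr pair; lia].
Qed.

Lemma vfaces_uniq v : uniq (vfaces v).
Proof. by case: v => [[k l] []] /=; rewrite !inE !xpair_eqE; lia. Qed.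

Lemma vfaces_adj v a b : a \in vfaces v -> b \in vfaces v -> a != b -> fadj a b.
Proof.
case: v a b => [[k l] []] [a1 a2] [b1 b2];
  rewrite /fadj /= !inE !xpair_eqE /=; lia.
Qed.

(** Each edge has one top end and one bottom end. *)
Lemma vfaces_inj (v w : vertex) a b : a != b -> v.2 = w.2 ->
  a \in vfaces v -> b \in vfaces v -> a \in vfaces w -> b \in vfaces w -> v = w.
Proof.
case: v w a b => [[k l] o] [[k' l'] o'] [a1 a2] [b1 b2] ab /= oo'.
rewrite -{}oo' => av bv aw bw; suff [-> ->] : k = k' /\ l = l' by [].
by case: o ab av bv aw bw; rewrite !inE !xpair_eqE; lia.
Qed.

Lemma vadj_sym v w : vadj v w = vadj w v.
Proof.
rewrite /vadj -!size_filter; congr (_ == _); apply/perm_size/uniq_perm;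
  rewrite ?filter_uniq ?vfaces_uniq // => u.
by rewrite !mem_filter andbC.
Qed.

Lemma vadj_common v w : vadj v w -> exists a b,
  [/\ a != b, a \in vfaces v, a \in vfaces w, b \in vfaces v & b \in vfaces w].
Proof.
rewrite /vadj -size_filter; have := filter_uniq (mem (vfaces w)) (vfaces_uniq v).
case E : [seq _ <- _ | _] => [|a [|b [|]]] //=; rewrite inE andbT => ab _.
have := mem_head a [:: b]; rewrite -E mem_filter => /andP[aw av].
have : b \in [:: a; b] by rewrite !inE eqxx orbT.
by rewrite -E mem_filter => /andP[bw bv]; exists a, b.
Qed.

(** Of the three faces around w, v misses exactly one, and so does x. *)
Lemma vadj_turn v w x b : vadj v w -> vadj w x -> b \in vfaces w ->
  b \in vfaces x -> b \notin vfaces v ->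
  exists2 a, a \in vfaces w /\ a \in vfaces v & a \notin vfaces x.
Proof.
rewrite vadj_sym /vadj => vw wx bw bx bv.
have [/hasP[a aw /andP[av ax]]|/hasPn none] :=
    boolP (has (fun a => (a \in vfaces v) && (a \notin vfaces x)) (vfaces w)).
  by exists a.
have sw := permP (perm_to_rem bw).
move: vw wx; rewrite !sw /= bx (negbTE bv) add0n add1n => /eqP <- /eqP e.
suff : (count (mem (vfaces v)) (rem b (vfaces w)) <=
        count (mem (vfaces x)) (rem b (vfaces w)))%N.
  by rewrite -e ltnn.
rewrite -!size_filter; apply: uniq_leq_size => [|a].
  by rewrite filter_uniq // rem_uniq ?vfaces_uniq.
rewrite !mem_filter => /andP[av aw]; rewrite aw andbT.
by have := none a (mem_rem aw); rewrite [a \in vfaces v]av negbK.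
Qed.

Lemma next_ind (T : eqType) (c : seq T) (P : T -> Prop) x : uniq c ->
  (forall y, y \in c -> P y -> P (next c y)) -> x \in c -> P x ->
  forall y, y \in c -> P y.
Proof.
move=> uc Pnext xc Px y; have [i q rq] := rot_to xc.
have := cycle_next uc; rewrite -(rot_cycle i) rq /= -(mem_rot i) rq.
rewrite rcons_path => /andP[+ _].
have {xc} : x \in c := xc.
elim: q x Px {rq} => [|z q IH] x Px xc /=; first by rewrite inE => _ /eqP ->.
case/andP=> /eqP xz pq; rewrite in_cons => /orP[/eqP -> //|].
by apply: IH => //; rewrite -xz; [apply: Pnext|rewrite mem_next].
Qed.

Section Domain.
Variable Om : domain.
Let c := boundary Om.
Let F := dfaces Om.
Let step (u v : face) := fadj u v && ~~ separated c u v.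

Lemma separated_sym u v : separated c u v = separated c v u.
Proof. by apply: eq_has => e; rewrite andbC. Qed.

Lemma step_sym u v : step u v = step v u.
Proof. by rewrite /step fadj_sym separated_sym. Qed.

(** A face that can be reached without crossing the boundary has the same
    component. *)
Lemma step_in u v : step u v -> (u \in F) = (v \in F).
Proof.
have H a b : step a b -> a \in F -> b \in F.
  move=> ab /dfacesP aF; apply/dfacesP; apply: sub_finite_set aF => x [p pp lp].
  by exists (b :: p) => //=; rewrite -/(step a b) ab.
move=> uv; apply/idP/idP; [exact: H|apply: H; by rewrite step_sym].
Qed.

(** A face outside the domain has an infinite component, which therefore leaves any
    box and avoids the domain: the domain has no hole. *)
Lemma acyclic_domain : acyclic F.
Proof.
have [m Fm] := box_sup F.
refine (acyclic_no_hole (@acyclic_box m) Fm _) => u uF.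
have : ~ enclosed c u by move/dfacesP; apply/negP.
rewrite /enclosed => infC.
have [v [[p pp lp] vB]] : exists v, component c u v /\ v \notin box m.
  apply: contrapT => nv; apply: infC.
  apply: (@sub_finite_set _ _ [set` box m]); last exact: finite_fset.
  by move=> v cv /=; apply: contrapT => /negP vB; apply: nv; exists v.
exists p; split; last by rewrite lp.
  by apply: sub_path pp => a b /andP[].
move=> w; elim: p u uF pp {lp infC} => [|b p IH] u uF /=.
  by rewrite inE => _ /eqP ->.
case/andP => ub pp; rewrite in_cons => /orP[/eqP -> //|].
by apply: IH => //; rewrite -(step_in ub).
Qed.


Lemma cycle_sideP u : reflect
  (u \in F /\ exists2 v, v \in c & (u \in vfaces v) && (u \in vfaces (next c v)))
  (bdry_face Om u).
Proof.
have sideE v : (u \in sides (if is_top v then (v, next c v) else (next c v, v))) =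
    (u \in vfaces v) && (u \in vfaces (next c v)).
  by case: ifP => _; rewrite mem_filter //= andbC.
apply: (iffP andP) => -[uF H]; split=> //.
  by move: H; rewrite has_map => /hasP[v vc /=]; rewrite sideE; exists v.
by have [v vc ?] := H; rewrite has_map; apply/hasP; exists v; rewrite //= sideE.
Qed.

Lemma separatedP u v : reflect
  (exists2 x, x \in c & [&& u \in vfaces x, u \in vfaces (next c x),
                            v \in vfaces x & v \in vfaces (next c x)])
  (separated c u v).
Proof.
have sideE w x : (w \in sides (if is_top x then (x, next c x) else (next c x, x))) =
    (w \in vfaces x) && (w \in vfaces (next c x)).
  by case: ifP => _; rewrite mem_filter //= andbC.
rewrite /separated has_map; apply: (iffP hasP) => -[x xc] /=.
  by rewrite !sideE -andbA; exists x.
by move=> h; exists x; rewrite //= !sideE -andbA.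
Qed.

(** When the boundary, going through x and y, exposes a new face b of the domain
    after y, the edge of y that the boundary does not use joins b to a face a that
    was already exposed before y; hence a belongs to the domain too. *)
Lemma boundary_turn x b : x \in c -> let y := next c x in
  b \in F -> b \in vfaces y -> b \in vfaces (next c y) -> b \notin vfaces x ->
  exists a, [/\ a \in F, a \in vfaces x, a \in vfaces y & fadj a b].
Proof.
move=> xc y bF byy bz bx.
have [/andP[cc uc] sc] := boundaryP Om.
have yc : y \in c by rewrite mem_next.
have xy : vadj x y by apply: next_cycle.
have yz : vadj y (next c y) by apply: next_cycle.
have [a [ay ax] az] := vadj_turn xy yz byy bz bx.
have ab : a != b by apply: contraNneq bx => <-.
have fab : fadj a b by apply: vfaces_adj ay byy ab.
exists a; split => //; rewrite (@step_in a b) // /step fab /=.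
(* A boundary edge between a and b would have y as one of its ends, since an edge
   has one end of each kind; but y is preceded by x, which misses b, and followed
   by a vertex that misses a. *)
apply/separatedP => -[w wc /and4P[aw aw' bw bw']].
have opp v v' : vadj v v' -> v != v' -> v.2 != v'.2.
  move=> vv' nv; apply: contra nv => /eqP e.
  have [a' [b' [ab' av av' bv bv']]] := vadj_common vv'.
  by apply/eqP; apply: vfaces_inj ab' e av bv av' bv'.
have nextN v : v \in c -> next c v != v.
  move=> vc; have [i q rq] := rot_to vc.
  have : (2 < size (v :: q))%N by rewrite -rq size_rot.
  rewrite -(next_rot i uc) rq /=; case: q rq => [|v' q] rq //= _.
  rewrite eqxx; move: uc; rewrite -(rot_uniq i) rq /= inE.
  by case/andP; rewrite negb_or eq_sym => /andP[].
have wy : w != y.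
  by apply: contraNneq az => <-.
have w'y : next c w != y.
  apply: contra bx => /eqP /(can_inj (prev_next uc)) <- //.
have := opp _ _ (next_cycle cc wc); rewrite eq_sym nextN // => /(_ isT).
have [e|e] := eqVneq w.2 y.2.
  by rewrite (vfaces_inj ab e aw bw ay byy) eqxx in wy.
have [e'|e'] := eqVneq (next c w).2 y.2.
  by rewrite (vfaces_inj ab e' aw' bw' ay byy) eqxx in w'y.
by move: e e'; case: (w.2); case: (y.2); case: ((next c w).2).
Qed.

(** The function a is a primitive of the variation of t inside the + region of s,
    which is a cocycle since t is constant across the interfaces of s.  If t
    vanishes on the boundary faces, a does not vary between adjacent ones, so
    following the boundary cycle shows that it is constant on all of them, and the
    constant is normalised to 0. *)
Lemma domain_split (s t : face -> bool) :
  (forall u v, u \in F -> v \in F -> fadj u v -> s u != s v -> t u = t v) ->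
  exists2 a : face -> bool,
    forall u v, u \in F -> v \in F -> fadj u v -> a u (+) a v = [&& s u, s v & t u (+) t v] &
    (forall u, bdry_face Om u -> t u = false) -> forall u, bdry_face Om u -> a u = false.
Proof.
move=> st; pose phi u v := [&& s u, s v & t u (+) t v].
have [u v|u v w uF vF wF uv vw uw|psi psiP] := @acyclic_domain phi.
- by rewrite /phi andbCA addbC.
- have := st u v uF vF uv; have := st v w vF wF vw; have := st u w uF wF uw.
  rewrite /phi; move: (s u) (s v) (s w) (t u) (t v) (t w).
  by do 6 case; move=> //= h1 h2 h3;
    first [by have := h1 isT|by have := h2 isT|by have := h3 isT].
have [[u0 u0b]|nob] := pselect (exists u, bdry_face Om u); last first.
  by exists psi => // _ u ub; case: nob; exists u.
exists (fun u => psi u (+) psi u0) => [u v uF vF uv|tb].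
  by rewrite addbACA addbb addbF; apply: psiP.
have bF u : bdry_face Om u -> u \in F by case/cycle_sideP.
have eqb u v : bdry_face Om u -> bdry_face Om v -> fadj u v -> psi u = psi v.
  move=> ub vb uv; have := psiP u v (bF _ ub) (bF _ vb) uv.
  by rewrite /phi !tb // !andbF; case: (psi u); case: (psi v).
have [/andP[cc uc] _] := boundaryP Om.
pose P x := forall u, u \in F -> u \in vfaces x -> u \in vfaces (next c x) ->
  psi u = psi u0.
have [_ [x0 x0c /andP[u0x u0y]]] := cycle_sideP _ u0b.
have bdry_side x u : x \in c -> u \in F -> u \in vfaces x -> u \in vfaces (next c x) ->
    bdry_face Om u.
  by move=> xc uF ux uy; apply/cycle_sideP; split=> //; exists x; rewrite ?ux.
have P0 : P x0.
  move=> u uF ux uy; have [-> //|nu] := eqVneq u u0.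
  apply: eqb => //; first exact: bdry_side x0c uF ux uy.
  exact: vfaces_adj ux u0x nu.
have Pnext x : x \in c -> P x -> P (next c x).
  move=> xc Px b bF' bx by'; have [bx'|bx'] := boolP (b \in vfaces x); first exact: Px.
  have [a [aF ax ay ab]] := boundary_turn xc bF' bx by' bx'.
  rewrite -(Px a) //; apply: esym; apply: eqb => //.
    exact: bdry_side xc aF ax ay.
  by apply: bdry_side bF' bx by'; rewrite mem_next.
move=> u /cycle_sideP[uF [x xc /andP[ux uy]]].
by rewrite (next_ind uc Pnext x0c P0 xc u uF ux uy) addbb.
Qed.
End Domain.

From mathcomp Require Import all_reals all_analysis.

Import numFieldNormedType.Exports.
Local Open Scope classical_set_scope.
Local Open Scope ring_scope.

(** * From the extended law to finite sums *)

Lemma expectation_finite (R : realType) (d : measure_display)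
    (T : measurableType d) (P : probability T R) (K : finType) (Z : T -> K)
    (h : K -> R) : (forall k, measurable (Z @^-1` [set k])) ->
  ('E_P[fun t => h (Z t)])%E = (\sum_k (h k)%:E * P (Z @^-1` [set k]))%E.
Proof.
move=> mZ; rewrite unlock.
transitivity (\int[P]_t (\sum_k (h k)%:E * (\1_(Z @^-1` [set k]) t)%:E))%E.
  apply: eq_integral => t _; rewrite (bigD1 (Z t)) //= big1 ?adde0.
    by rewrite indicE mem_set // mule1.
  by move=> k kZ; rewrite indicE memNset ?mule0 // => /= e; rewrite e eqxx in kZ.
rewrite integral_sum //; last first.
  by move=> k; apply: integrableZl => //; exact: integrable_indic.
apply: eq_bigr => k _; rewrite integralZl //; last exact: integrable_indic.
by rewrite integral_indic // setIT.
Qed.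

Section UniformLaw.
Context (R : realType).
Notation U01 := (uniform_prob (@ltr01 R)).

Lemma uniform_prob_le (q : R) : 0 <= q <= 1 -> U01 [set u | u <= q] = q%:E.
Proof.
move=> /andP[q0 q1]; rewrite /uniform_prob integral_uniform_pdf.
rewrite (_ : _ `&` _ = `[0, q]%classic); last first.
  apply/seteqP; split => u /=; rewrite !in_itv /=; first by case=> -> /andP[->].
  by move=> /andP[u0 uq]; rewrite u0 uq (le_trans uq).
rewrite (eq_integral (fun=> 1%:E)); last first.
  move=> u; rewrite inE /= in_itv /= => /andP[u0 uq].
  by rewrite /uniform_pdf u0 (le_trans uq) // subr0 invr1.
rewrite integral_cst //= mul1e lebesgue_measure_itv /= lte_fin.
by case: ltgtP q0 => // [_ _|<- _]; rewrite ?oppr0 ?adde0 // sube0.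
Qed.

Lemma uniform_prob_gt (q : R) : 0 <= q <= 1 -> U01 [set u | 1 - q < u] = q%:E.
Proof.
move=> /andP[q0 q1].
have -> : [set u | 1 - q < u] = ~` [set u : R | u <= 1 - q].
  by apply/seteqP; split => u /=; rewrite ltNge => /negP.
rewrite probability_setC //; last first.
  by rewrite -[X in measurable X]set_itvE; exact: measurable_itv.
have e : U01 [set u | u <= 1 - q] = (1 - q)%:E.
  by rewrite uniform_prob_le // subr_ge0 q1 lerBlDr lerDl.
by rewrite [X in (_ - X)%E]e -EFinB subKr.
Qed.

End UniformLaw.

Section Law.
Context (R : realType) (Om : domain) (d : measure_display)
  (T : measurableType d) (P : probability T R) (p : state Om -> R)
  (S : T -> state Om) (U : dY Om -> T -> R).
Hypothesis law : extended_law P p S U.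
Context (B : set R) (q : R).
Hypothesis mB : measurable B.
Hypothesis pB : uniform_prob (@ltr01 R) B = q%:E.

Definition hits (t : T) : {set dY Om} := [set y | U y t \in B]%SET.

Lemma mem_hits t y : (y \in hits t) = (U y t \in B).
Proof. by rewrite inE. Qed.

(** Everything of interest depends on the uniform variables only through the
    Bernoulli set [hits]. *)
Lemma expectation_law (h : state Om -> {set dY Om} -> R) :
  ('E_P[fun t => h (S t) (hits t)])%E =
  (\sum_s p s * \sum_W bernoulli q W * h s W)%:E.
Proof.
have [mS mU PSU] := law.
pose BW (W : {set dY Om}) y := if y \in W then B else ~` B.
have mBW W y : measurable (BW W y).
  by rewrite /BW; case: ifP => // _; exact: measurableC.
have fiberE s W : (fun t => (S t, hits t)) @^-1` [set (s, W)] =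
    [set t | S t = s /\ forall y, BW W y (U y t)].
  apply/seteqP; split => t /=.
    case=> -> <-; split=> // y; rewrite /BW /hits inE.
    by case: ifPn => [/set_mem|/negP yB yB'] //; apply: yB; exact: mem_set.
  case=> -> h1; congr pair; apply/setP => y; rewrite /hits inE.
  by have := h1 y; rewrite /BW; case: ifP => _; [exact: mem_set|exact: memNset].
have PW s W : P ((fun t => (S t, hits t)) @^-1` [set (s, W)]) = (p s * bernoulli q W)%:E.
  rewrite fiberE PSU // EFinM; congr (_ * _)%E.
  rewrite /bernoulli -prodEFin; apply: eq_bigr => y _; rewrite /BW; case: ifP => // _.
  by rewrite probability_setC // [X in (_ - X)%E]pB.
rewrite (@expectation_finite _ _ _ P _ (fun t => (S t, hits t)) (fun k => h k.1 k.2)).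
  transitivity (\sum_k (h k.1 k.2 * (p k.1 * bernoulli q k.2))%:E)%E.
    by apply: eq_bigr => -[s W] _; rewrite PW -EFinM.
  rewrite sumEFin -(pair_bigA _ (fun s W => h s W * (p s * bernoulli q W))) /=.
  congr _%:E; apply: eq_bigr => s _; rewrite mulr_sumr.
  by apply: eq_bigr => W _; ring.
move=> [s W]; rewrite fiberE.
rewrite (_ : [set t | _ ] = [set t | S t = s] `&`
   \big[setI/setT]_(y : dY Om) (U y @^-1` BW W y)).
  apply: measurableI => //; apply: bigsetI_measurable => y _.
  by rewrite -[X in measurable X]setTI; apply: mU.
apply/seteqP; split => t /= [-> h1]; split => //.
  by rewrite -bigcap_seq => y _; apply: h1.
by move=> y; move: h1; rewrite -bigcap_seq; apply; rewrite /= mem_index_enum.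
Qed.
End Law.

(** * The spin model of a domain *)

Lemma vfaces_fvertices v u : u \in vfaces v -> v \in fvertices u.
Proof.
case: v u => [[k l] b] [a c]; rewrite /fvertices.
case: b => /=; rewrite !inE !xpair_eqE /=; lia.
Qed.

Lemma separating_edge (y : vertex) a b : is_top y -> a \in vfaces y -> b \in vfaces y ->
  a != b -> exists w, [/\ vadj y w, a \in vfaces w & b \in vfaces w].
Proof.
case: y => [[k l] o] /= ->.
have e1 : vadj ((k, l), true) ((k, l), false).
  by rewrite /vadj /= !inE !xpair_eqE; lia.
have e2 : vadj ((k, l), true) ((k - 1, l + 1), false).
  by rewrite /vadj /= !inE !xpair_eqE; lia.
have e3 : vadj ((k, l), true) ((k, l + 1), false).
  by rewrite /vadj /= !inE !xpair_eqE; lia.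
rewrite !inE => /or3P[]/eqP-> /or3P[]/eqP->; rewrite ?eqxx // => _.
- by exists ((k, l), false); split; rewrite // /vfaces /= !inE !xpair_eqE; lia.
- by exists ((k - 1, l + 1), false); split; rewrite // /vfaces /= !inE !xpair_eqE; lia.
- by exists ((k, l), false); split; rewrite // /vfaces /= !inE !xpair_eqE; lia.
- by exists ((k, l + 1), false); split; rewrite // /vfaces /= !inE !xpair_eqE; lia.
- by exists ((k - 1, l + 1), false); split; rewrite // /vfaces /= !inE !xpair_eqE; lia.
- by exists ((k, l + 1), false); split; rewrite // /vfaces /= !inE !xpair_eqE; lia.
Qed.

Section DomainModel.
Variable Om : domain.

Definition dadj : rel (dfaces Om) := fun u v => fadj (val u) (val v).
Definition nbr (y : dY Om) : {set dfaces Om} := [set u | val u \in vfaces (val y)]%SET.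
(** Pinning nothing encodes a free boundary condition. *)
Definition pin_set (b : option bool) : {set dfaces Om} :=
  if b is Some _ then [set u : dfaces Om | bdry_face Om (val u)]%SET else finset.set0.

Lemma nbr_clique y u v : u \in nbr y -> v \in nbr y -> u != v -> dadj u v.
Proof. by rewrite !inE => uy vy uv; apply: vfaces_adj uy vy _. Qed.

Lemma mem_fvertices v u : v \in fvertices u -> u \in vfaces v.
Proof.
case: v u => [[k l] b] [a c]; rewrite /fvertices !inE !xpair_eqE /=.
by case: b => /=; rewrite ?xpair_eqE; lia.
Qed.

Lemma nbr_neq0 y : nbr y != finset.set0.
Proof.
case: y => y yY; have := yY; rewrite !inE /= => /andP[/orP[yb|yf] /andP[_ nb]].
  by rewrite yb in nb.
have /flattenP[_ /mapP[u uF ->] /mem_fvertices yu] := yf.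
by apply/set0Pn; exists [` uF]%fset; rewrite inE.
Qed.

Lemma bdryF u : bdry_face Om u -> u \in dfaces Om. Proof. by case/andP. Qed.

Lemma domain_model_split (b : option bool) (s t : spins Om) :
  (forall u v, dadj u v -> s u != s v -> t u = t v) ->
  (forall u, u \in pin_set b -> t u = false) ->
  exists2 a : spins Om,
    forall u v, dadj u v -> a u (+) a v = [&& s u, s v & t u (+) t v] &
    forall u, u \in pin_set b -> a u = false.
Proof.
move=> st tb.
pose ext (r : spins Om) (u : face) := if insub u is Some w then r w else false.
have extE r (w : dfaces Om) : ext r (val w) = r w by rewrite /ext valK.
have [u v uF vF uv|a aE aD] := @domain_split Om (ext s) (ext t).
  by rewrite -[u]/(val [` uF]%fset) -[v]/(val [` vF]%fset) !extE; apply: st.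
exists [ffun u => a (val u)] => [u v uv|u ub].
  by rewrite !ffunE aE ?fsvalP // !extE.
rewrite ffunE; case: b ub tb => [b|]; rewrite ?inE // => ub tb.
by apply: aD => // w wb; rewrite -[w]/(val [` bdryF wb]%fset) extE tb // inE.
Qed.

Lemma aroundE b (s : spins Om) y :
  around b s y = (nbr y \subset if b then plus s else ~: plus s)%SET.
Proof.
apply/forallP/fintype.subsetP => [h u|h u].
  by rewrite inE => uy; have := h u; rewrite uy => /eqP; case: b h => h e; rewrite !inE e.
apply/implyP => uy; have := h u; rewrite inE uy => /(_ isT).
by case: b h => h; rewrite !inE; case: (s u).
Qed.

Lemma perpE (s : spins Om) y : perp s y = (y \notin mixed nbr (plus s)).
Proof.
rewrite !inE negbK; apply/existsP/orP => [[[]]|[]] h.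
- by left; rewrite -(aroundE true).
- by right; rewrite -(aroundE false).
- by exists true; rewrite aroundE.
- by exists false; rewrite aroundE.
Qed.

Lemma sidesP (e : edge) u : (u \in sides e) = (u \in vfaces e.1) && (u \in vfaces e.2).
Proof. by rewrite mem_filter andbC. Qed.

(** Two faces around y with different spins are separated by an edge ending at y;
    it is an edge of omega since y is not on the boundary cycle. *)
Lemma Yset_mixed (s : spins Om) : Yset s = mixed nbr (plus s).
Proof.
apply/setP => y; rewrite inE; apply/exists_inP/idP => [[e]|].
  rewrite inE => /andP[_ /existsP[u /existsP[v /and3P[ue ve suv]]]] ye.
  apply: contraLR suv => /(mixedPn nbr_neq0) h; rewrite negbK; apply/eqP.
  move: ue ve; rewrite !sidesP => /andP[u1 u2] /andP[v1 v2].
  by apply: h; rewrite inE; case/orP: ye => /eqP ->.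
rewrite -[y \in _]negbK => /(mixedPn nbr_neq0) h.
have yY := valP y; move: (yY); rewrite !inE => /andP[yV /andP[yt yb]].
have [u [v [uy vy suv]]] : exists u v, [/\ u \in nbr y, v \in nbr y & s u != s v].
  apply: contrapT => nuv; apply: h => u v uy vy; apply/eqP; apply: contraT => suv.
  by case: nuv; exists u, v.
have uv : val u != val v by apply: contraNneq suv => /val_inj ->.
move: (uy) (vy); rewrite !inE => uy' vy'.
have [w [yw uw vw]] := separating_edge yt uy' vy' uv.
have us : val u \in sides (val y, w) by rewrite sidesP uy'.
have vs : val v \in sides (val y, w) by rewrite sidesP vy'.
have wV : w \in dvertices Om.
  rewrite !inE; apply/orP; right; apply/flattenP; exists (fvertices (val u)).
    by apply: map_f; apply: valP.
  exact: vfaces_fvertices.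
have eE : (val y, w) \in dedges Om.
  rewrite !inE /is_edge /= yt yw; apply/andP; split.
    by apply: allpairs_f => //; rewrite !inE.
  by apply/orP; right; apply/hasP; exists (val u) => //; apply: valP.
exists [` eE]%fset; last by rewrite /= eqxx.
rewrite inE /=; apply/andP; split; last first.
  by apply/existsP; exists u; apply/existsP; exists v; rewrite us vs.
apply: contra yb => /mapP[x xc]; case: ifP => _ [/= e _];
  by rewrite /= e ?mem_next.
Qed.

Lemma weight_pair (R : realType) (x : R) (s : state Om) :
  weight x s = pair_weight dadj nbr (x ^+ 2) s.1 s.2.
Proof. by rewrite /weight /pair_weight !Yset_mixed. Qed.

Lemma pinned_bc (b : option bool) (s : spins Om) :
  pinned (pin_set b) (odflt false b) s = satisfies_bc b s.
Proof.
case: b => [b|] /=; last by apply/forall_inP => u; rewrite inE.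
by apply: eq_forallb => u; rewrite inE.
Qed.

Lemma mem_perco (s t : spins Om) (W : {set dY Om}) y : (y \in perco nbr s t W) =
  (y \notin mixed nbr (plus s)) && ((y \in W) || (y \in mixed nbr (plus t))).
Proof. by rewrite finset.in_setD finset.in_setU. Qed.

Lemma black_perco (s t : spins Om) (W : {set dY Om}) y :
  (if ~~ perp s y then false else if ~~ perp t y then true else y \in W) =
  (y \in perco nbr s t W).
Proof.
rewrite !perpE !negbK mem_perco.
by case: (y \in mixed _ _); case: (y \in mixed _ _); rewrite ?orbT ?orbF.
Qed.

(** For consistent pairs the order of the two tests does not matter, so the two
    colours play symmetric roles. *)
Lemma white_perco (s t : spins Om) (W : {set dY Om}) y : agree dadj s t ->
  (if ~~ perp t y then true else if ~~ perp s y then false else y \in W) =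
  (y \in perco nbr s t W).
Proof.
move=> st; have dis := @disjointFr _ _ _ y (agree_disjoint nbr_clique nbr_neq0 st).
rewrite !perpE !negbK mem_perco.
move: dis; case: (y \in mixed nbr (plus s)) => [->|_] //.
by case: (y \in mixed nbr (plus t)); rewrite ?orbT ?orbF.
Qed.

Lemma agree_sym (s t : spins Om) : agree dadj s t = agree dadj t s.
Proof. by rewrite /agree; apply: eq_forallb => u; apply: eq_forallb => v; rewrite orbC. Qed.

Lemma pair_weight_sym (R : realFieldType) (p : R) (s t : spins Om) :
  pair_weight dadj nbr p s t = pair_weight dadj nbr p t s.
Proof. by rewrite /pair_weight agree_sym finset.setUC. Qed.
End DomainModel.

(** * FKG for the triplets *)

(** The two colours are treated at once: [own] is the colour of the triplet, [other]
    the remaining one, and B the set of values of the uniform variables that open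
    a vertex. *)
Section Transfer.
Context (R : realType) (Om : domain).

(** The point of the triplet space given by the + set and the open vertices
    surrounded by + and by -. *)
Definition encode (A : {set dfaces Om}) (V W : {set dY Om}) (i : triplet_index Om) : R :=
  match i with
  | inl u => if u \in A then 1 else -1
  | inr (inl y) => (y \in V)%:R
  | inr (inr y) => - (y \in W)%:R
  end.

Lemma encode_in A V W : product_set (triplet_space R) (encode A V W).
Proof.
case=> [u|[y|y]] /=; first by case: ifP; [right|left].
  by case: (_ \in _); [right|left].
by case: (_ \in _); [left|right; rewrite oppr0].
Qed.

Lemma increasing_encode f : increasing_on (triplet_space R) f ->
  increasing3 (fun A V W => f (encode A V W)).
Proof.
move=> fi A A' V V' W W' AA VV WW; apply: fi; [exact: encode_in|exact: encode_in|].
case=> [u|[y|y]] /=.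
- have := fintype.subsetP AA u; case: (u \in A) => [/(_ isT) -> //|_].
  by case: ifP => // _; lra.
- by rewrite ler_nat; have := fintype.subsetP VV y; case: (y \in V) => [->|_].
- by rewrite lerN2 ler_nat; have := fintype.subsetP WW y; case: (y \in W') => [->|_].
Qed.

Lemma triplet_encode (s : spins Om) (xi : dY Om -> bool) (V : {set dY Om}) :
  (forall y, xi y = (y \in V)) ->
  triplet R s xi = encode (plus s) (V :&: inside (@nbr Om) (plus s))%SET
                                   (V :&: inside (@nbr Om) (~: plus s))%SET.
Proof.
move=> xiV; apply/funext => -[u|[y|y]] /=; first by rewrite inE.
  by rewrite !inE xiV aroundE.
by rewrite !inE xiV aroundE.
Qed.

Context (x : R) (hx0 : 0 < x) (hx1 : x <= 1).
Context (d : measure_display) (T : measurableType d) (P : probability T R)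
  (S : T -> state Om) (U : dY Om -> T -> R) (p : state Om -> R).
Hypothesis law : extended_law P p S U.
Context (own other : state Om -> spins Om) (xi : state Om -> {set dY Om} -> dY Om -> bool).
Hypothesis own_other : forall G : spins Om -> spins Om -> R,
  \sum_s G (own s) (other s) = \sum_a \sum_b G a b.
Hypothesis xiE : forall s W y, agree (@dadj Om) (own s) (other s) ->
  xi s W y = (y \in perco (@nbr Om) (own s) (other s) W).
Context (B : set R) (mB : measurable B)
  (pB : uniform_prob (@ltr01 R) B = (x ^+ 2)%:E).
Context (Q : pred {set dfaces Om}) (b : option bool) (c : R).
Hypothesis QQ : forall A A', Q A -> Q A' -> Q (A :|: A')%SET && Q (A :&: A')%SET.
Hypothesis pE : forall s, p s =
  c * (Q (plus (own s)) && satisfies_bc b (other s))%:R * weight x s.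
Hypothesis weight_own : forall s, weight x s =
  pair_weight (@dadj Om) (@nbr Om) (x ^+ 2) (own s) (other s).

Let tot := spin_mass (@dadj Om) (@nbr Om) (pin_set Om b) (odflt false b) (x ^+ 2) Q.

Lemma expectation_total (f : (triplet_index Om -> R) -> R) :
  ('E_P[fun t => f (triplet R (own (S t)) (xi (S t) (hits U B t)))])%E =
  (c * tot (fun A V W => f (encode A V W)))%:E.
Proof.
rewrite (expectation_law law mB pB (fun s W => f (triplet R (own s) (xi s W)))).
congr _%:E; rewrite /tot /spin_mass.
pose G s t : R := c * (if Q (plus s) then if pinned (pin_set Om b) (odflt false b) t then
   pair_weight (@dadj Om) (@nbr Om) (x ^+ 2) s t * \sum_W bernoulli (x ^+ 2) W *
     f (encode (plus s) (perco (@nbr Om) s t W :&: inside (@nbr Om) (plus s))%SET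
                        (perco (@nbr Om) s t W :&: inside (@nbr Om) (~: plus s))%SET)
     else 0 else 0).
transitivity (\sum_s G (own s) (other s)).
  apply: eq_bigr => s _; rewrite pE weight_own /G pinned_bc -!mulrA; congr (_ * _).
  case: (Q _); last by rewrite mul0r.
  case: (satisfies_bc _ _); rewrite ?mul1r ?mul0r //=.
  rewrite /pair_weight; case: ifP => [ag|_]; last by rewrite !mul0r.
  congr (_ * _); apply: eq_bigr => W _; congr (_ * f _).
  by apply: triplet_encode => y; apply: xiE.
rewrite own_other mulr_sumr [RHS]big_mkcond /=; apply: eq_bigr => s _.
rewrite /G; case: (Q _); last by rewrite big1 // => t _; rewrite mulr0.
by rewrite mulr_sumr [RHS]big_mkcond /=; apply: eq_bigr => t _; case: ifP; rewrite ?mulr0.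
Qed.

Lemma FKG_of_law : FKG P (triplet_space R)
  (fun t => triplet R (own (S t)) (xi (S t) (hits U B t))).
Proof.
move=> f g _ fi _ gi.
rewrite (expectation_total f) (expectation_total g)
  (expectation_total (fun z => f z * g z)).
(* The constant 1 has expectation 1, which normalises the mass. *)
have c1 : c * tot (fun _ _ _ => 1) = 1.
  have := expectation_total (fun=> 1).
  by rewrite (expectation_cst P 1) => -[<-].
rewrite -EFinM lee_fin -[leRHS]mulr1 -c1 mulrACA [leRHS]mulrACA.
apply: ler_wpM2l; first by rewrite -expr2 sqr_ge0.
apply: model_fkg.
- by rewrite exprn_gt0.
- by rewrite exprn_ile1 // ltW.
- exact: nbr_clique.
- exact: nbr_neq0.
- exact: domain_model_split.
- exact: QQ.
- exact: increasing_encode.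
- exact: increasing_encode.
Qed.
End Transfer.

Section Colours.
Context (R : realType) (Om : domain) (x : R) (hx0 : 0 < x) (hx1 : x <= 1).
Context (d : measure_display) (T : measurableType d) (P : probability T R)
  (S : T -> state Om) (U : dY Om -> T -> R) (p : state Om -> R).
Hypothesis law : extended_law P p S U.
Context (Q : pred {set dfaces Om}) (b : option bool) (c : R).
Hypothesis QQ : forall A A', Q A -> Q A' -> Q (A :|: A')%SET && Q (A :&: A')%SET.

Let sqx : 0 <= x ^+ 2 <= 1.
Proof. by rewrite sqr_ge0 exprn_ile1 // ltW. Qed.

Lemma FKG_black :
  (forall s, p s = c * (Q (plus s.1) && satisfies_bc b s.2)%:R * weight x s) ->
  FKG P (triplet_space R) (black_triplet x S U).
Proof.
move=> pE; pose B := [set u : R | u <= x ^+ 2].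
have mB : measurable B by rewrite -[X in measurable X]set_itvE; exact: measurable_itv.
have -> : black_triplet x S U = fun t => triplet R (S t).1 (fun y =>
    if ~~ perp (S t).1 y then false else if ~~ perp (S t).2 y then true
    else y \in hits U B t).
  apply/funext => t; congr triplet; apply/funext => y; rewrite /xi_black mem_hits.
  by do 2 case: ifP => // _; apply/idP/idP => [|/set_mem //]; exact: mem_set.
apply: (FKG_of_law hx0 hx1 law (own := fst) (other := snd) (xi := fun s W y =>
  if ~~ perp s.1 y then false else if ~~ perp s.2 y then true else y \in W)
  _ _ mB (uniform_prob_le sqx) QQ pE).
- by move=> G; rewrite -(pair_bigA _ G).
- by move=> s W y _; apply: black_perco.
- exact: weight_pair.
Qed.

Lemma FKG_white :
  (forall s, p s = c * (Q (plus s.2) && satisfies_bc b s.1)%:R * weight x s) ->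
  FKG P (triplet_space R) (white_triplet x S U).
Proof.
move=> pE; pose B := [set u : R | 1 - x ^+ 2 < u].
have mB : measurable B by rewrite -[X in measurable X]set_itvE; exact: measurable_itv.
have -> : white_triplet x S U = fun t => triplet R (S t).2 (fun y =>
    if ~~ perp (S t).1 y then true else if ~~ perp (S t).2 y then false
    else y \in hits U B t).
  apply/funext => t; congr triplet; apply/funext => y; rewrite /xi_white mem_hits.
  by do 2 case: ifP => // _; apply/idP/idP => [|/set_mem //]; exact: mem_set.
apply: (FKG_of_law hx0 hx1 law (own := snd) (other := fst) (xi := fun s W y =>
  if ~~ perp s.1 y then true else if ~~ perp s.2 y then false else y \in W)
  _ _ mB (uniform_prob_gt sqx) QQ pE).
- by move=> G; rewrite exchange_big -(pair_bigA _ (fun a b => G b a)).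
- by move=> s W y st; apply: white_perco.
- by move=> s; rewrite weight_pair pair_weight_sym.
Qed.
End Colours.

Section Conditioning.
Context (Om : domain).

(** Boundary conditions and conditionings on the colour of the triplet, as
    sublattices of sets of faces. *)
Definition bc_set (b : option bool) (A : {set dfaces Om}) : bool :=
  if b is Some v then [forall u : dfaces Om, bdry_face Om (val u) ==> ((u \in A) == v)]
  else true.

Definition fixed_set (A0 : {set dfaces Om}) (tau : {u : dfaces Om | u \in A0} -> bool)
    (A : {set dfaces Om}) : bool :=
  [forall a : {u : dfaces Om | u \in A0}, (val a \in A) == tau a].

Lemma bc_set_lattice b A A' : bc_set b A -> bc_set b A' ->
  bc_set b (A :|: A')%SET && bc_set b (A :&: A')%SET.
Proof.
case: b => [v|] //= /forallP h /forallP h'; apply/andP; split; apply/forallP => u;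
  have := h u; have := h' u; rewrite !inE; case: (bdry_face _ _) => //= /eqP-> /eqP->;
  by rewrite ?orbb ?andbb.
Qed.

Lemma fixed_set_lattice (A0 : {set dfaces Om})
    (tau : {u : dfaces Om | u \in A0} -> bool) A A' :
  fixed_set tau A -> fixed_set tau A' ->
  fixed_set tau (A :|: A')%SET && fixed_set tau (A :&: A')%SET.
Proof.
move=> /forallP h /forallP h'; apply/andP; split; apply/forallP => u;
  have := h u; have := h' u; rewrite !inE => /eqP-> /eqP->;
  by rewrite ?orbb ?andbb.
Qed.

Lemma bc_set_plus b (s : spins Om) : bc_set b (plus s) = satisfies_bc b s.
Proof. by case: b => [v|] //=; apply: eq_forallb => u; rewrite inE. Qed.

Lemma fixed_set_plus (A0 : {set dfaces Om})
    (tau : {u : dfaces Om | u \in A0} -> bool) (s : state Om) :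
  fixed_set tau (plus s.1) = (s \in black_on tau).
Proof. by rewrite inE; apply: eq_forallb => u; rewrite inE. Qed.

Lemma condE (R : realType) (p : state Om -> R) (C : {set state Om}) s :
  cond p C s = (\sum_(t in C) p t)^-1 * (s \in C)%:R * p s.
Proof. by rewrite /cond; case: ifP => _; rewrite ?mulr1 ?mulr0 ?mul0r // mulrC. Qed.

End Conditioning.

Theorem proposition3p10 (R : realType) (Om : domain) (x : R)
    (hx0 : 0 < x) (hx1 : x <= 1)
    (d : measure_display) (T : measurableType d) (P : probability T R)
    (S : T -> state Om) (U : dY Om -> T -> R) :
  (forall bb bw : option bool,
     extended_law P (Spin_bc x bb bw) S U ->
     FKG P (triplet_space R) (black_triplet x S U) /\
     FKG P (triplet_space R) (white_triplet x S U)) /\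
  (forall (A : {set dfaces Om}) (tau : {u : dfaces Om | u \in A} -> bool),
     (extended_law P (cond (Spin x) (black_on tau)) S U ->
      FKG P (triplet_space R) (black_triplet x S U)) /\
     (extended_law P (cond (Spin_bc x None (Some true)) (black_on tau)) S U ->
      FKG P (triplet_space R) (black_triplet x S U))).
Proof.
have SpinE (C : {set state Om}) s : cond (Spin x) C s =
    ((\sum_(t in C) Spin x t)^-1 / \sum_(t : state Om) weight x t) *
    (s \in C)%:R * weight x s.
  by rewrite condE /Spin; ring.
split=> [bb bw law|A tau].
  split.
    apply: (FKG_black hx0 hx1 law (@bc_set_lattice Om bb) (b := bw)) => s.
    by rewrite /Spin_bc SpinE inE bc_set_plus.
  apply: (FKG_white hx0 hx1 law (@bc_set_lattice Om bw) (b := bb)) => s.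
  by rewrite /Spin_bc SpinE inE bc_set_plus andbC.
split=> law.
  apply: (FKG_black hx0 hx1 law (@fixed_set_lattice Om A tau) (b := None)) => s.
  by rewrite SpinE fixed_set_plus andbT.
apply: (FKG_black hx0 hx1 law (@fixed_set_lattice Om A tau) (b := Some true)) => s.
rewrite condE /Spin_bc SpinE fixed_set_plus; set C := [set _ | _]%SET.
have -> : (s \in C) = satisfies_bc (Some true) s.2 by rewrite inE.
by rewrite -mulnb natrM !mulrA; congr (_ * _ * _); rewrite [X in X / _]mulrAC [LHS]mulrAC.
Qed.
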